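(* Let $a,b\in\mathbb R$ with $b\ne0$. The sequence $(c_n(a,b))_{n\ge0}$ is positive definite if and only if $a^2+3b\ge0$. Moreover, if $a>0$, then for the corresponding probability distribution $\mu(a,b)$: (i) if $b<0\le a^2+3b$, the support of $\mu(a,b)$ is contained in $[0,\tau_+(a,b)]$; (ii) if $b>0$, the support of $\mu(a,b)$ is contained in $[\tau_-(a,b),\tau_+(a,b)]$.
   Context: $c_n(a,b)$ is defined by $c_0(a,b)=1$ and, for $n\ge1$, $c_n(a,b)=a\sum_{u_1+u_2=n-1}c_{u_1}(a,b)c_{u_2}(a,b)+b\sum_{u_1+u_2+u_3=n-2}c_{u_1}(a,b)c_{u_2}(a,b)c_{u_3}(a,b)$ (sums over nonnegative integers $u_i$). A real sequence is positive definite if it is the moment sequence of a positive measure on $\mathbb R$; $\mu(a,b)$ is the (unique) probability measure with moments $c_n(a,b)$. For $a^2+3b\ge0$ put $z_\pm(a,b)=\dfrac{-2a^3-9ab\pm2(a^2+3b)^{3/2}}{27b^2}$ and $\tau_\pm(a,b)=1/z_\pm(a,b)$; when $a^2+4b\ne0$ this equals $\tau_\pm(a,b)=\dfrac{2a^3+9ab\pm2(a^2+3b)^{3/2}}{a^2+4b}$, and $\tau_+(a,-a^2/4)=27a/8$. *)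

(* Defs.v *)
From HB Require Import structures.
From mathcomp Require Import all_boot all_order all_algebra.
From mathcomp Require Import all_classical all_reals all_analysis.

Set Implicit Arguments.
Unset Strict Implicit.
Unset Printing Implicit Defensive.

Import Order.TTheory GRing.Theory Num.Theory.
Import numFieldNormedType.Exports.

Local Open Scope classical_set_scope.
Local Open Scope ring_scope.

Section CSequence.
Context {R : realType}.
Implicit Types (a b : R) (f : nat -> R) (n : nat).

(* Right-hand side of the recurrence for c_n.  It only uses the values f u with
   u < n, and the conditions u1 + u2 = n - 1 and u1 + u2 + u3 = n - 2 are stated
   without truncated subtraction, so that the last sum is empty for n = 1. *)
Definition c_step a b f n : R :=
  if n == 0%N then 1 else
    a * (\sum_(u1 < n) \sum_(u2 < n | (u1 + u2 + 1 == n)%N) f u1 * f u2)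
  + b * (\sum_(u1 < n) \sum_(u2 < n) \sum_(u3 < n | (u1 + u2 + u3 + 2 == n)%N)
           f u1 * f u2 * f u3).

(* [:: c_0; ...; c_(n-1)] *)
Fixpoint c_prefix a b n : seq R :=
  if n is m.+1 then
    rcons (c_prefix a b m) (c_step a b (nth 0 (c_prefix a b m)) m)
  else [::].

Definition c a b n : R := nth 0 (c_prefix a b n.+1) n.

Lemma size_c_prefix a b n : size (c_prefix a b n) = n.
Proof. by elim: n => //= n IHn; rewrite size_rcons IHn. Qed.

Lemma nth_c_prefix a b n i : (i < n)%N -> nth 0 (c_prefix a b n) i = c a b i.
Proof.
elim: n => // n IHn; rewrite ltnS leq_eqVlt => /predU1P[-> //|lt_in].
by rewrite /= nth_rcons size_c_prefix lt_in IHn.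
Qed.

Lemma cE a b n : c a b n = c_step a b (c a b) n.
Proof.
rewrite {1}/c /= nth_rcons size_c_prefix ltnn eqxx /c_step.
case: eqP => // _; congr (a * _ + b * _).
  by apply: eq_bigr => i _; apply: eq_bigr => j _; rewrite !nth_c_prefix.
apply: eq_bigr => i _; apply: eq_bigr => j _; apply: eq_bigr => k _.
by rewrite !nth_c_prefix.
Qed.

Lemma c0 a b : c a b 0 = 1.
Proof. by rewrite cE. Qed.

Lemma c_rec a b n : (0 < n)%N ->
  c a b n =
    a * (\sum_(u1 < n) \sum_(u2 < n | (u1 + u2 + 1 == n)%N) c a b u1 * c a b u2)
  + b * (\sum_(u1 < n) \sum_(u2 < n) \sum_(u3 < n | (u1 + u2 + u3 + 2 == n)%N)
           c a b u1 * c a b u2 * c a b u3).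
Proof. by rewrite cE /c_step lt0n => /negPf ->. Qed.

End CSequence.

Section Moments.
Context {R : realType}.
Implicit Types (mu : {measure set (measurableTypeR R) -> \bar R}) (s : nat -> R).

Definition has_moments mu s : Prop :=
  forall n : nat,
    mu.-integrable [set: measurableTypeR R] (fun x => (x ^+ n)%:E) /\
    (\int[mu]_x (x ^+ n)%:E = (s n)%:E)%E.

Definition positive_definite s : Prop :=
  exists mu : {measure set (measurableTypeR R) -> \bar R}, has_moments mu s.

Definition measure_support mu : set R :=
  [set x | forall U : set R, open U -> U x -> (0 < mu U)%E].

End Moments.

Section Endpoints.
Context {R : realType}.
Implicit Types a b : R.

Definition z_plus a b : R :=
  (- 2 * a ^+ 3 - 9 * a * b + 2 * (a ^+ 2 + 3 * b) `^ (3 / 2)) / (27 * b ^+ 2).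

Definition z_minus a b : R :=
  (- 2 * a ^+ 3 - 9 * a * b - 2 * (a ^+ 2 + 3 * b) `^ (3 / 2)) / (27 * b ^+ 2).

Definition tau_plus a b : R := 1 / z_plus a b.

Definition tau_minus a b : R := 1 / z_minus a b.

End Endpoints.

(* Main.v *)
(* Write D(z) = sum c_n z^(n+1), the inverse of P(w) = w - a w^2 - b w^3, and
   L(t^n) = c_n.  Since sum c_(i+j) z^i z'^j = (D(z) - D(z')) / (z - z'), the
   substitution z = P(w) turns the Hankel form L(p q) into the kernel
   (w - w') / (P(w) - P(w')) = 1 / (1 - a (w + w') - b (w^2 + w w' + w'^2)).
   - If b > 0, put R(w) = 1 - a w - b w^2: the kernel multiplied by R(w) R(w') is
     the geometric series of (1 - R)(1 - R)' + b w w', so it is positive.  If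
     b < 0 <= a^2 + 3 b, it is a similar nested combination of Cauchy kernels.
     Positivity and geometric growth of c_n give a measure (Bernstein operators
     and a weak limit).
   - If a^2 + 3 b < 0, positivity of the Taylor coefficients of the kernel
     propagates from w = 0 along the real line, up to w = -a/(3b) where the
     coefficient of x y is negative.
   - The kernel stays positive when one adds the point evaluation at any w of the
     monotonicity interval of P around 0.  For z = P(w) this reads
     L(p)^2 P'(w) <= L(p^2 (1 - z t)^2), and locally uniform inequalities of this
     kind show that 1/z is not in the support. *)

Require Import Defs.
From HB Require Import structures.
From mathcomp Require Import all_boot all_order all_algebra.
From mathcomp Require Import all_classical all_reals all_analysis.
From mathcomp Require Import measurable_realfun ring lra zify.

Set Implicit Arguments.
Unset Strict Implicit.
Unset Printing Implicit Defensive.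

Import Order.TTheory GRing.Theory Num.Theory.
Import numFieldNormedType.Exports.

Local Open Scope classical_set_scope.
Local Open Scope ring_scope.

(** * Hankel forms and the backward shift *)

(** The variable w of the kernel becomes the operator T = D(V) on polynomials, V being the backward
    shift. V is locally nilpotent, so power series in it are finite sums, the kernel identities need
    no convergence, and positivity can be proved by induction on the degree. The support inequality
    is formally Cauchy-Schwarz for L(p) = L(p (1 - z t) / (1 - z t)) with L(1 / (1 - z t)^2) = D'(z)
    = 1 / P'(w). The obstacle is that 1 / (1 - z t) can be integrated only once 1/z is known to be
    off the support; it is therefore adjoined to the polynomials as a formal vector on which T acts
    as the scalar w, and positivity is proved on the enlarged space. The endpoints are the values
    1/P(w) at the critical points w of P that bound the monotonicity interval around 0. *)

Section BackwardShift.
Variables (R : realType) (a b : R).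
Local Notation c := (c a b).

Definition mom (s : nat -> R) (p : {poly R}) : R := \sum_(i < size p) p`_i * s i.

Lemma mom_widen s n (p : {poly R}) : (size p <= n)%N -> mom s p = \sum_(i < n) p`_i * s i.
Proof.
move=> pn; rewrite /mom (big_ord_widen _ (fun i => p`_i * s i) pn) big_mkcond/=.
by apply: eq_bigr => i _; case: ltnP => // /leq_sizeP ->; rewrite ?mul0r.
Qed.

Lemma mom_is_linear s : linear_for *%R (mom s).
Proof.
move=> k p q; pose n := maxn (size p) (size q).
have hp : (size p <= n)%N by exact: leq_maxl.
have hq : (size q <= n)%N by exact: leq_maxr.
have hpq : (size (k *: p + q)%R <= n)%N.
  by rewrite (leq_trans (size_polyD _ _))// geq_max hq (leq_trans (size_scale_leq _ _)).
rewrite (mom_widen s hpq) (mom_widen s hp) (mom_widen s hq) mulr_sumr -big_split/=.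
by apply: eq_bigr => i _; rewrite coefD coefZ; ring.
Qed.

HB.instance Definition _ s :=
  GRing.isLinear.Build R {poly R} R *%R (mom s) (mom_is_linear s).

Lemma momXn s n : mom s 'X^n = s n.
Proof.
rewrite /mom size_polyXn (bigD1 ord_max)//= coefXn eqxx mul1r big1 ?addr0// => i.
by rewrite coefXn -val_eqE/= => /negPf ->; rewrite mul0r.
Qed.

(* [shiftT] is D(V), where V is the backward shift [drop_poly 1] and D(z) is the
   generating function z C(z), the inverse of z - a z^2 - b z^3. *)
Definition shiftT (p : {poly R}) : {poly R} :=
  \sum_(n < size p) c n *: drop_poly n.+1 p.

Lemma shiftT_widen n (p : {poly R}) : (size p <= n.+1)%N ->
  shiftT p = \sum_(i < n) c i *: drop_poly i.+1 p.
Proof.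
move=> pn; have pn2 : (size p <= maxn (size p) n)%N by exact: leq_maxl.
have n2 : (n <= maxn (size p) n)%N by exact: leq_maxr.
rewrite /shiftT (big_ord_widen _ (fun i => c i *: drop_poly i.+1 p) pn2).
rewrite (big_ord_widen _ (fun i => c i *: drop_poly i.+1 p) n2).
rewrite big_mkcond [RHS]big_mkcond/=; apply: eq_bigr => i _.
case: ltnP => h1; case: ltnP => h2 //; rewrite drop_poly_eq0 ?scaler0//.
  by rewrite (leq_trans pn).
by rewrite (leq_trans h1).
Qed.

Lemma shiftT_is_linear : linear shiftT.
Proof.
move=> k p q; pose n := maxn (size p) (size q).
have hp : (size p <= n.+1)%N by rewrite leqW// leq_maxl.
have hq : (size q <= n.+1)%N by rewrite leqW// leq_maxr.
have hpq : (size (k *: p + q)%R <= n.+1)%N.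
  by rewrite (leq_trans (size_polyD _ _))// geq_max hq (leq_trans (size_scale_leq _ _)).
rewrite (shiftT_widen hpq) (shiftT_widen hp) (shiftT_widen hq) scaler_sumr -big_split/=.
by apply: eq_bigr => i _; rewrite linearP scalerDr !scalerA mulrC.
Qed.

HB.instance Definition _ :=
  GRing.isLinear.Build R {poly R} {poly R} *:%R shiftT shiftT_is_linear.

Lemma drop_poly_drop m n (p : {poly R}) : drop_poly m (drop_poly n p) = drop_poly (m + n) p.
Proof. by apply/polyP => i; rewrite !coef_drop_poly addnA. Qed.

Lemma size_shiftT n (p : {poly R}) : (size p <= n.+1)%N -> (size (shiftT p) <= n)%N.
Proof.
move=> pn; rewrite /shiftT; apply: (leq_trans (size_sum _ _ _)).
apply/bigmax_leqP => i _; rewrite (leq_trans (size_scale_leq _ _))// size_drop_poly.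
by rewrite leq_subLR (leq_trans pn)// addSn ltnS leq_addl.
Qed.

Lemma shiftT2 n (p : {poly R}) : (size p <= n)%N -> shiftT (shiftT p) =
  \sum_(u < n) \sum_(v < n) (c u * c v) *: drop_poly (u + v + 2) p.
Proof.
move=> pn; rewrite [shiftT p](@shiftT_widen n) ?leqW// linear_sum; apply: eq_bigr => i _.
rewrite linearZ/= (@shiftT_widen n) ?size_drop_poly; last first.
  by rewrite (leq_trans (leq_subr _ _)) ?leqW.
rewrite scaler_sumr; apply: eq_bigr => j _.
by rewrite scalerA drop_poly_drop; congr (_ *: drop_poly _ _); rewrite addn2 addSn addnS addnC.
Qed.

Lemma shiftT3 n (p : {poly R}) : (size p <= n)%N -> shiftT (shiftT (shiftT p)) =
  \sum_(u < n) \sum_(v < n) \sum_(x < n) (c u * c v * c x) *: drop_poly (u + v + x + 3) p.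
Proof.
move=> pn; rewrite (shiftT2 pn) linear_sum; apply: eq_bigr => i _.
rewrite linear_sum; apply: eq_bigr => j _.
rewrite linearZ/= (@shiftT_widen n) ?size_drop_poly; last first.
  by rewrite (leq_trans (leq_subr _ _)) ?leqW.
rewrite scaler_sumr; apply: eq_bigr => k _.
rewrite scalerA drop_poly_drop; congr (_ *: drop_poly _ _).
by rewrite addn2 addn3 addSn !addnS addnC.
Qed.

(** Ranges independent of [n] and index conditions in Kronecker form let these sums be exchanged
    with a sum over [n]. *)
Lemma c_widen N n : (n <= N)%N -> c n = (n == 0%N)%:R
  + a * (\sum_(u < N) \sum_(v < N) (if (u + v + 1 == n)%N then c u * c v else 0))
  + b * (\sum_(u < N) \sum_(v < N) \sum_(x < N)
           (if (u + v + x + 2 == n)%N then c u * c v * c x else 0)).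
Proof.
move=> nN; rewrite cE /c_step.
have [->|n0] := eqVneq n 0%N.
  rewrite big1 ?mulr0 ?addr0; last by move=> u _; rewrite big1// => v _; rewrite addn1.
  rewrite big1 ?mulr0 ?addr0// => u _; rewrite big1// => v _.
  by rewrite big1// => x _; rewrite addn2.
rewrite add0r; congr (_ * _ + _ * _).
  rewrite (big_ord_widen _ (fun u => \sum_(u2 < n | (u + u2 + 1 == n)%N) c u * c u2) nN).
  rewrite big_mkcond; apply: eq_bigr => u _ /=; case: ltnP => ui; last first.
    rewrite big1// => v _; rewrite gtn_eqF//.
    by rewrite addn1 ltnS (leq_trans ui)// leq_addr.
  rewrite (big_ord_widen_cond _ (fun u2 => (u + u2 + 1 == n)%N) (fun u2 => c u * c u2) nN).
  rewrite big_mkcond; apply: eq_bigr => v _ /=; case: eqP => //= <-.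
  by rewrite addn1 ltnS leq_addl.
rewrite (big_ord_widen _ (fun u => \sum_(u2 < n) \sum_(u3 < n | (u + u2 + u3 + 2 == n)%N)
  c u * c u2 * c u3) nN).
rewrite big_mkcond; apply: eq_bigr => u _ /=; case: ltnP => ui; last first.
  rewrite big1// => v _; rewrite big1// => x _; rewrite gtn_eqF//.
  by rewrite addn2 ltnS (leq_trans ui)// leqW// -addnA leq_addr.
rewrite (big_ord_widen _ (fun u2 => \sum_(u3 < n | (u + u2 + u3 + 2 == n)%N)
  c u * c u2 * c u3) nN).
rewrite big_mkcond; apply: eq_bigr => v _ /=; case: ltnP => vi; last first.
  rewrite big1// => x _; rewrite gtn_eqF//.
  by rewrite addn2 ltnS (leq_trans vi)// leqW// addnAC leq_addl.
rewrite (big_ord_widen_cond _ (fun u3 => (u + v + u3 + 2 == n)%N)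
  (fun u3 => c u * c v * c u3) nN).
rewrite big_mkcond; apply: eq_bigr => x _ /=; case: eqP => //= <-.
by rewrite addn2 ltnS leqW// leq_addl.
Qed.

(** The recurrence says D = z + a D^2 + b D^3; this is the same identity with V in place of z, that
    is, P(T) = V. *)
Lemma shiftT_eq p :
  shiftT p = drop_poly 1 p + a *: shiftT (shiftT p) + b *: shiftT (shiftT (shiftT p)).
Proof.
pose n := size p.
have dn m : (n <= m)%N -> drop_poly m p = 0 by exact: drop_poly_eq0.
rewrite (shiftT3 (leqnn n)) (shiftT2 (leqnn n)).
case n0 : n => [|n'].
  rewrite /shiftT -/n n0 !big_ord0 !scaler0 !addr0 dn// n0//.
rewrite -n0.
have -> : shiftT p = \sum_(i < n) ((i == 0 :> nat)%:R *: drop_poly i.+1 p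
  + a *: (\sum_(u < n) \sum_(v < n) (if (u + v + 1 == i)%N then c u * c v else 0) *: drop_poly i.+1 p)
  + b *: (\sum_(u < n) \sum_(v < n) \sum_(x < n) (if (u + v + x + 2 == i)%N then c u * c v * c x else 0) *: drop_poly i.+1 p)).
  apply: eq_bigr => i _; rewrite {1}(c_widen (ltnW (ltn_ord i))) !scalerDl -!scalerA.
  congr (_ + _ *: _ + _ *: _); rewrite scaler_suml; apply: eq_bigr => u _.
    by rewrite scaler_suml.
  by rewrite scaler_suml; apply: eq_bigr => v _; rewrite scaler_suml.
have pick (k : nat) (r : R) : \sum_(i < n) (if (k == i)%N then r else 0) *: drop_poly i.+1 p =
    r *: drop_poly k.+1 p.
  have [kn|kn] := ltnP k n.
    rewrite (bigD1 (Ordinal kn))//= eqxx big1 ?addr0// => i.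
    by rewrite -val_eqE/= eq_sym => /negPf ->; rewrite scale0r.
  rewrite dn ?leqW// scaler0 big1// => i _.
  by rewrite gtn_eqF ?scale0r// (leq_trans (ltn_ord i)).
rewrite !big_split/= -!scaler_sumr; congr (_ + _ *: _ + _ *: _).
- rewrite -[RHS]scale1r -(pick 0%N 1); apply: eq_bigr => i _; rewrite eq_sym.
  by case: eqP.
- rewrite exchange_big; apply: eq_bigr => u _; rewrite exchange_big; apply: eq_bigr => v _.
  by rewrite pick addn2 addn1.
- rewrite exchange_big; apply: eq_bigr => u _; rewrite exchange_big; apply: eq_bigr => v _.
  rewrite exchange_big; apply: eq_bigr => x _.
  by rewrite pick addn3 addn2.
Qed.

Lemma mom_drop (p : {poly R}) : mom c (drop_poly 1 p) = (shiftT p)`_0.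
Proof.
rewrite (@mom_widen _ (size p)) ?size_drop_poly ?leq_subr// /shiftT coef_sum.
by apply: eq_bigr => i _; rewrite coefZ !coef_drop_poly add0n addn1 mulrC.
Qed.

Lemma drop1E (p : {poly R}) : p = (p`_0)%:P + 'X * drop_poly 1 p.
Proof.
apply/polyP => -[|i]; rewrite coefD coefC coefXM/= ?addr0//.
by rewrite add0r coef_drop_poly addn1.
Qed.

Lemma drop1X (p : {poly R}) : drop_poly 1 ('X * p) = p.
Proof. by apply/polyP => i; rewrite coef_drop_poly addn1 coefXM. Qed.

(** Let N(x, y) = (P(x) - P(y)) / (x - y), where x and y act as T on the two arguments: N times the
    Hankel form is evaluation at 0 in both. The defect C satisfies C(V u, v) = C(u, V v), and a
    power of V kills one argument. *)
Lemma momM_kernel (p q : {poly R}) : let L p q := mom c (p * q) in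
  L p q - a * (L (shiftT p) q + L p (shiftT q))
        - b * (L (shiftT (shiftT p)) q + L (shiftT p) (shiftT q)
               + L p (shiftT (shiftT q))) = p`_0 * q`_0.
Proof.
pose L p q := mom c (p * q); rewrite /= -/(L p q).
pose C p q := L p q - a * (L (shiftT p) q + L p (shiftT q))
        - b * (L (shiftT (shiftT p)) q + L (shiftT p) (shiftT q)
               + L p (shiftT (shiftT q))) - p`_0 * q`_0.
rewrite -!/(L _ _); suff: C p q = 0 by move/eqP; rewrite subr_eq0 => /eqP.
have LDl u v x : L (u + v) x = L u x + L v x by rewrite /L mulrDl linearD.
have LDr u v x : L x (u + v) = L x u + L x v by rewrite /L mulrDr linearD.
have LZl k u x : L (k *: u) x = k * L u x by rewrite /L -scalerAl linearZ.
have LZr k u x : L x (k *: u) = k * L x u by rewrite /L -scalerAr linearZ.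
(* The terms X (V u) (V v) cancel; what remains is the bilinear form of (D(z) - D(z')) / (z -
   z'). *)
have Lshift u v : L (drop_poly 1 u) v - L u (drop_poly 1 v) =
    (shiftT u)`_0 * v`_0 - u`_0 * (shiftT v)`_0.
  rewrite /L {1}(drop1E v) {2}(drop1E u) mulrDr mulrDl !mul_polyC (mulrC _ (v`_0)%:P).
  rewrite mul_polyC mulrCA -mulrA !linearD !linearZ/= !mom_drop; ring.
have CV u v : C (drop_poly 1 u) v = C u (drop_poly 1 v).
  have VE x : drop_poly 1 x = shiftT x + (- a) *: shiftT (shiftT x) + (- b) *: shiftT (shiftT (shiftT x)).
    have mv (d t A B : {poly R}) : t = d + A + B -> d = t + - A + - B by move=> ->; ring.
    by rewrite !scaleNr; apply: mv; exact: shiftT_eq.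
  (* P(x) - P(y) = (x - y) N(x, y) turns [Lshift] into the symmetry of C under T, hence under V, a
     polynomial in T. *)
  have CT x y : C (shiftT x) y = C x (shiftT y).
    have := Lshift x y; rewrite !VE !(LDl, LDr, LZl, LZr) /C => h.
    have e0 (r1 r2 r3 r4 : R) : r1 = r2 -> r3 - r4 = r1 - r2 -> r3 = r4.
      by move=> -> /eqP; rewrite subrr subr_eq0 => /eqP.
    by apply: (e0 _ _ _ _ h); ring.
  have CL k x y z : C (k *: x + y) z = k * C x z + C y z.
    by rewrite /C !(linearP, coefD, coefZ) !(LDl, LDr, LZl, LZr); ring.
  have CR k x y z : C z (k *: x + y) = k * C z x + C z y.
    by rewrite /C !(linearP, coefD, coefZ) !(LDl, LDr, LZl, LZr); ring.
  rewrite !VE -![shiftT _ + _ + _]addrA ![shiftT _ + (_ + _)]addrC -!addrA.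
  by rewrite !CL !CR !CT.
have CVn n u v : C (drop_poly n u) v = C u (drop_poly n v).
  elim: n u v => [|n IHn] u v; first by rewrite !drop_poly0l.
  by rewrite -addn1 -drop_poly_drop IHn CV drop_poly_drop addn1.
(* p = V^n (X^n p) with n the size of q, and V^n q = 0. *)
rewrite -(drop_polyMXn_id (size q) p) CVn drop_poly_eq0//.
by rewrite /C !linear0 /L !mulr0 !linear0 coef0; ring.
Qed.

End BackwardShift.

(* With z + |a| w^2 + |b| w^3 <= w the partial sums of sum |c_n| z^(n+1) stay below w. *)
Lemma c_geometric (R : realType) (a b : R) :
  exists K M, [/\ 0 <= K, 1 <= M & forall n, `|c a b n| <= K * M ^+ n].
Proof.
(* With w = 1 / (2 d) one has d w^2 = w / 2, which bounds the quadratic and cubic terms together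
   because w <= 1; the other half of w is left for z. *)
pose d := 1 + `|a| + `|b|.
have d1 : 1 <= d by rewrite /d -addrA lerDl addr_ge0.
have d0 : 0 < d by exact: lt_le_trans d1.
pose w := (2 * d)^-1; pose z := w / 2.
have w0 : 0 < w by rewrite invr_gt0 mulr_gt0.
have z0 : 0 < z by rewrite divr_gt0.
have w1 : w <= 1 by rewrite invf_le1 ?mulr_gt0//; lra.
have zw : z + `|a| * w ^+ 2 + `|b| * w ^+ 3 <= w.
  have w3 : `|b| * w ^+ 3 <= `|b| * w ^+ 2 by rewrite ler_wpM2l// ler_wiXn2l// ltW.
  have e : (`|a| + `|b|) * w ^+ 2 <= w / 2.
    have -> : w / 2 = d * w ^+ 2 by rewrite /w; field; exact: lt0r_neq0.
    by rewrite ler_wpM2r ?sqr_ge0// /d -addrA lerDr.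
  rewrite mulrDl in e; rewrite /z; lra.
pose t n := `|c a b n| * z ^+ n.+1.
have t0 n : 0 <= t n by rewrite mulr_ge0// exprn_ge0// ltW.
have tw N : \sum_(n < N) t n <= w.
  elim: N => [|N IHN]; first by rewrite big_ord0 ltW.
  set S := \sum_(n < N) t n in IHN.
  have S0 : 0 <= S by exact: sumr_ge0.
  apply: (@le_trans _ _ (z + `|a| * S ^+ 2 + `|b| * S ^+ 3)); last first.
    apply: le_trans zw; apply: lerD; last by rewrite ler_wpM2l// lerXn2r// nnegrE// ltW.
    by apply: lerD => //; rewrite ler_wpM2l// lerXn2r// nnegrE// ltW.
  have pick (k : nat) (r : R) : 0 <= r -> \sum_(n < N.+1) (if (k == n)%N then r else 0) <= r.
    move=> r0; have [kn|kn] := ltnP k N.+1.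
      rewrite (bigD1 (Ordinal kn))//= eqxx big1 ?addr0// => i.
      by rewrite -val_eqE/= eq_sym => /negPf ->.
    rewrite big1// => i _; rewrite gtn_eqF// (leq_trans (ltn_ord i))//.
  apply: (@le_trans _ _ (\sum_(n < N.+1) ((if (0 == n)%N then z else 0)
    + `|a| * (\sum_(u < N) \sum_(v < N) (if (u + v + 1 == n)%N then t u * t v else 0))
    + `|b| * (\sum_(u < N) \sum_(v < N) \sum_(x < N)
           (if (u + v + x + 2 == n)%N then t u * t v * t x else 0))))).
    apply: ler_sum => n _; rewrite /t (c_widen a b (ltn_ord n : (n <= N)%N)).
    have zn : 0 <= z ^+ n.+1 by rewrite exprn_ge0// ltW.
    rewrite -[X in _ * X](ger0_norm zn) -normrM !mulrDl.
    apply: (le_trans (ler_normD _ _)); apply: lerD.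
      apply: (le_trans (ler_normD _ _)); apply: lerD.
        rewrite normrM (ger0_norm zn) eq_sym; case: eqP => [<-|_]; first by rewrite normr1 mul1r.
        by rewrite normr0 mul0r.
      rewrite -mulrA normrM ler_wpM2l// mulr_suml; apply: (le_trans (ler_norm_sum _ _ _)).
      apply: ler_sum => u _; rewrite mulr_suml; apply: (le_trans (ler_norm_sum _ _ _)).
      apply: ler_sum => v _; case: eqP => [<-|_]; last by rewrite mul0r normr0.
      rewrite !normrM (ger0_norm (exprn_ge0 _ (ltW z0))) le_eqVlt; apply/predU1P; left.
      by rewrite addn1 -addSn -addnS exprD; ring.
    rewrite -mulrA normrM ler_wpM2l// mulr_suml; apply: (le_trans (ler_norm_sum _ _ _)).
    apply: ler_sum => u _; rewrite mulr_suml; apply: (le_trans (ler_norm_sum _ _ _)).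
    apply: ler_sum => v _; rewrite mulr_suml; apply: (le_trans (ler_norm_sum _ _ _)).
    apply: ler_sum => x _; case: eqP => [<-|_]; last by rewrite mul0r normr0.
    rewrite !normrM (ger0_norm (exprn_ge0 _ (ltW z0))) le_eqVlt; apply/predU1P; left.
    rewrite (_ : (u + v + x + 2).+1 = (u.+1 + v.+1 + x.+1)%N) ?exprD; last by lia.
    by ring.
  rewrite !big_split/= -!mulr_sumr; apply: lerD; first apply: lerD.
  - by apply: pick; exact: ltW.
  - rewrite ler_wpM2l// exchange_big expr2 mulr_suml/=; apply: ler_sum => u _.
    rewrite exchange_big mulr_sumr/=; apply: ler_sum => v _.
    by apply: pick; rewrite mulr_ge0.
  - rewrite ler_wpM2l// exchange_big exprS expr2 mulr_suml/=; apply: ler_sum => u _.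
    rewrite exchange_big mulr_suml mulr_sumr/=; apply: ler_sum => v _.
    rewrite exchange_big mulr_sumr mulr_sumr/=; apply: ler_sum => x _.
    by rewrite mulrA; apply: pick; apply: mulr_ge0 => //; exact: mulr_ge0.
exists (w / z), z^-1; split.
- by rewrite divr_ge0// ltW.
- by rewrite invf_ge1// (le_trans _ w1)// /z; lra.
- move=> n; have : t n <= w.
    by apply: le_trans (tw n.+1); rewrite big_ord_recr/= lerDr sumr_ge0.
  rewrite /t exprS mulrA -ler_pdivlMr ?exprn_gt0// -ler_pdivlMr// mulrAC => h.
  by rewrite exprVn.
Qed.

(** * Positivity of the kernel *)

(** B plays the Hankel form, [Nid] is the kernel equation and [Nw] says P'(w) > 0. The filtration
    [lev] carries the inductions: T lowers the level down to 0, where it is the scalar w. *)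
Section AbstractPositivity.
Variables (R : realType) (E : lmodType R) (T : {linear E -> E}).
Variables (B : E -> E -> R) (eps : E -> R) (lev : nat -> E -> Prop) (w : R).
Hypothesis BC : forall u v, B u v = B v u.
Hypothesis BL : forall k u v x, B (k *: u + v) x = k * B u x + B v x.
Hypothesis levL : forall n k u v, lev n u -> lev n v -> lev n (k *: u + v).
Hypothesis levS : forall n u, lev n u -> lev n.+1 u.
Hypothesis levT : forall n u, lev n.+1 u -> lev n (T u).
Hypothesis lev0T : forall u, lev 0 u -> T u = w *: u.
Hypothesis lev0B : forall u, lev 0 u -> 0 <= B u u.

Let BDl u v x : B (u + v) x = B u x + B v x.
Proof. by rewrite -[u]scale1r BL mul1r scale1r. Qed.

Let B0l x : B 0 x = 0.
Proof. by have := BDl 0 0 x; rewrite addr0 => /eqP; rewrite -subr_eq0 opprD addrA subrr add0r oppr_eq0 => /eqP. Qed.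

Let BZl k u x : B (k *: u) x = k * B u x.
Proof. by rewrite -[k *: u]addr0 BL B0l addr0. Qed.

Let BNl u x : B (- u) x = - B u x.
Proof. by rewrite -scaleN1r BZl mulN1r. Qed.

Let BDr u v x : B x (u + v) = B x u + B x v.
Proof. by rewrite BC BDl !(BC x). Qed.

Let BZr k u x : B x (k *: u) = k * B x u.
Proof. by rewrite BC BZl BC. Qed.

Let BNr u x : B x (- u) = - B x u.
Proof. by rewrite BC BNl BC. Qed.

Let Bexp := (BDl, BDr, BZl, BZr, BNl, BNr).
Let TD x y : T (x + y) = T x + T y. Proof. exact: linearD. Qed.
Let TN x : T (- x) = - T x. Proof. exact: linearN. Qed.
Let TZ k x : T (k *: x) = k *: T x. Proof. exact: linearZ. Qed.
Let Texp := (TD, TN, TZ).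

Let lev_0 n u : lev n u -> lev n 0.
Proof. by move=> h; have := levL (- 1) h h; rewrite scaleN1r addNr. Qed.

Let levZ n k u : lev n u -> lev n (k *: u).
Proof. by move=> h; rewrite -[k *: u]addr0; apply: levL => //; exact: lev_0 h. Qed.

Let levD n u v : lev n u -> lev n v -> lev n (u + v).
Proof. by move=> hu hv; rewrite -[u]scale1r; apply: levL. Qed.

Let levTn n u : lev n u -> lev n (T u).
Proof.
case: n => [|n] h; first by rewrite lev0T//; exact: levZ.
exact/levS/levT.
Qed.

(** On level 0 the operator 1 - p T - q T^2 is a nonzero scalar. One level up, u itself is an
    approximate solution whose error p T u + q T^2 u lies one level lower, where induction corrects
    it. *)
Lemma solve_unipotent (p q : R) n u : p * w + q * w ^+ 2 != 1 -> lev n u ->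
  exists2 v, lev n v & v - (p *: T v + q *: T (T v)) = u.
Proof.
move=> pq1; elim: n u => [|n IHn] u hu.
  exists ((1 - (p * w + q * w ^+ 2))^-1 *: u); first exact: levZ.
  rewrite !TZ (lev0T hu) TZ (lev0T hu) !scalerA -scalerDl -scalerBl.
  rewrite -[RHS]scale1r; congr (_ *: _); field.
  by rewrite subr_eq0 eq_sym.
have [|v hv ev] := IHn (p *: T u + q *: T (T u)).
  by apply: levD; apply: levZ; [exact: levT|apply: levTn; exact: levT].
exists (u + v); first by apply: levD => //; exact: levS.
rewrite !TD !scalerDr [_ + _ + (_ + _)]addrACA opprD addrACA ev.
by rewrite subrK.
Qed.

Variables (a b : R).
Hypothesis Nid : forall u v,
  B u v - a * (B (T u) v + B u (T v))
        - b * (B (T (T u)) v + B (T u) (T v) + B u (T (T v))) = eps u * eps v.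
Hypothesis Nw : 0 < 1 - 2 * a * w - 3 * b * w ^+ 2.

Lemma psd_of_pos n u : 0 < b -> lev n u -> 0 <= B u u.
Proof.
move=> b0; elim: n u => [|n IHn] u hu; first exact: lev0B.
(* R(T) is invertible: a w + b w^2 = 1 would give P'(w) = -1 - b w^2 < 0. *)
have [|v hv <-] := solve_unipotent (p := a) (q := b) _ hu.
  have := mulr_ge0 (ltW b0) (sqr_ge0 w); move: Nw.
  by move=> h1 h2; apply/eqP => h; lra.
(* From R R' = N + (1 - R) (1 - R)' + b w w'; apart from eps only vectors of level n remain. *)
have -> : B (v - (a *: T v + b *: T (T v))) (v - (a *: T v + b *: T (T v))) =
  eps v ^+ 2 + B (a *: T v + b *: T (T v)) (a *: T v + b *: T (T v))
  + b * B (T v) (T v).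
  rewrite expr2 -Nid !Bexp (BC (T v) v) (BC (T (T v)) v) (BC (T (T v)) (T v)).
  by ring.
have hT : lev n (T v) by exact: levT.
apply: addr_ge0; last by apply: mulr_ge0; [exact: ltW|exact: IHn].
apply: addr_ge0; first exact: sqr_ge0.
by apply: IHn; apply: levD; apply: levZ => //; exact: levTn.
Qed.

(* With X = a/(3 beta) - T the kernel is the inverse of
   beta (X^2 + X Y + Y^2 - 4 cc^2) = beta ((f + f') (g + g') - X Y), where
   f = X + cc and g = X - cc; [B2] is the kernel multiplied by f + f'. *)
Lemma psd_of_neg_gt0 n u : b < 0 -> 0 <= a ^+ 2 + 3 * b -> 0 < a ->
  0 < a + 3 * b * w -> lev n u -> 0 <= B u u.
Proof.
move=> b0 ab a0 aw.
pose be := - b; pose x0 := a / (3 * be).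
have be0 : 0 < be by rewrite oppr_gt0.
have x00 : 0 < x0 by rewrite divr_gt0// mulr_gt0.
have aE : a = 3 * be * x0 by rewrite /x0; field; exact: lt0r_neq0.
have bE : b = - be by rewrite opprK.
(* The discriminant condition enters here: 4 cc^2 is this quantity, so f and g are real. *)
have c2 : 0 <= 3 * x0 ^+ 2 - be^-1.
  have -> : 3 * x0 ^+ 2 - be^-1 = (a ^+ 2 + 3 * b) / (3 * be ^+ 2).
    by rewrite bE aE; field; exact: lt0r_neq0.
  by rewrite divr_ge0// mulr_ge0// sqr_ge0.
pose cc : R := Num.sqrt (3 * x0 ^+ 2 - be^-1) / 2.
have cc0 : 0 <= cc by rewrite divr_ge0// sqrtr_ge0.
have rel : 3 * be * x0 ^+ 2 - 4 * be * cc ^+ 2 = 1.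
  by rewrite [cc ^+ 2]expr_div_n sqr_sqrtr//; field; exact: lt0r_neq0.
have := Nw; have := Nid; clear c2; clearbody cc x0 be.
rewrite {}aE {}bE in a0 b0 ab aw * => Nid' Nw'.
pose f0 := x0 + cc; pose g0 := x0 - cc.
have f00 : 0 < f0 by rewrite /f0; lra.
(* Used with x = 2 cc: beta (3 y^2 - 4 cc^2) equals 1 for y = x0 and P'(w) for y = x0 - w. *)
have sq_lt (x y : R) : 0 < y -> 0 < 3 * y ^+ 2 - x ^+ 2 -> 0 <= x -> x < 2 * y.
  move=> y0 xy x0'; rewrite -(@ltr_pXn2r _ 2)// ?nnegrE//; last by lra.
  by rewrite exprMn; have := sqr_ge0 y; lra.
have ccx0 : 2 * cc < 2 * x0.
  by apply: sq_lt; [|rewrite -(pmulr_rgt0 _ be0)|]; lra.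
have Xw : 0 < x0 - w by rewrite -(pmulr_rgt0 _ be0); lra.
have ccX : 2 * cc < 2 * (x0 - w).
  by apply: sq_lt; [|rewrite -(pmulr_rgt0 _ be0)|]; lra.
have g00 : 0 < g0 by rewrite /g0; lra.
have gw : 0 < 2 * g0 - w by rewrite /g0; lra.
pose B2 u v := 2 * f0 * B u v - B (T u) v - B u (T v).
pose G v := (2 * g0) *: v - T v; pose X v := x0 *: v - T v.
have NidE v : (3 * be * x0 ^+ 2 - 4 * be * cc ^+ 2) * B v v
    - 3 * be * x0 * (B (T v) v + B v (T v))
    + be * (B (T (T v)) v + B (T v) (T v) + B v (T (T v))) = eps v ^+ 2.
  by rewrite rel expr2 -Nid'; ring.
(* For G = 2 g0 - w one has G G' = 2 g0 (g + g') + w w'. Multiply by beta (f + f') and use the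
   kernel equation. *)
have id1 v : be * B2 (G v) (G v) =
    be * B2 (T v) (T v) + 2 * g0 * (eps v ^+ 2 + be * B (X v) (X v)).
  rewrite -NidE /B2 /G /X !Texp !Bexp (BC (T v) v) (BC (T (T v)) v)
    (BC (T (T v)) (T v)) /f0 /g0.
  by ring.
pose D := 4 * (x0 ^+ 2 - cc ^+ 2).
have D0 : 0 < D.
  have -> : D = 4 * ((x0 - cc) * (x0 + cc)) by rewrite /D; ring.
  by rewrite !mulr_gt0//; lra.
(* With R = 1 - a w - b w^2 and D = 4 f0 g0, the product D R R' is D N plus a nonnegative
   combination of products in which both factors contain T, so those vectors have lower level. *)
have id2 v : D * B (v - (3 * be * x0 *: T v + (- be) *: T (T v)))
                   (v - (3 * be * x0 *: T v + (- be) *: T (T v))) =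
    be ^+ 2 * B ((4 * cc ^+ 2) *: T v - x0 *: T (T v)) ((4 * cc ^+ 2) *: T v - x0 *: T (T v))
    + (be * (B (T (G v)) (T (G v)) + 2 * f0 * B2 (T v) (T v)) + D * eps v ^+ 2).
  have -> : v - (3 * be * x0 *: T v + (- be) *: T (T v)) =
      (3 * be * x0 ^+ 2 - 4 * be * cc ^+ 2) *: v
      - (3 * be * x0 *: T v + (- be) *: T (T v)) by rewrite rel scale1r.
  have m1 r : r = (3 * be * x0 ^+ 2 - 4 * be * cc ^+ 2) * r by rewrite rel mul1r.
  rewrite [X in _ = _ + X]m1 -NidE.
  rewrite /D /B2 /G /X !Texp !Bexp (BC (T v) v) (BC (T (T v)) v)
    (BC (T (T v)) (T v)) /f0 /g0.
  by ring.
suff : lev n u -> 0 <= B u u /\ 0 <= B2 u u by move=> + hu => /(_ hu)[].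
(* B at level n.+1 needs B and B2 at level n; B2 at level n.+1 then uses B at the same level, on
   [X v]. *)
elim: n u => [|n IHn] u hu.
  split; first exact: lev0B.
  rewrite /B2 (lev0T hu) !Bexp.
  have -> : 2 * f0 * B u u - w * B u u - w * B u u = (2 * f0 - 2 * w) * B u u by ring.
  by rewrite mulr_ge0//; [rewrite /f0; lra|exact: lev0B].
have Bn1 v : lev n.+1 v -> 0 <= B v v.
  move=> hv.
  have [|t ht <-] := solve_unipotent (p := 3 * be * x0) (q := - be) _ hv.
    by apply/eqP; nra.
  rewrite -(pmulr_rge0 _ D0) id2.
  have hT : lev n (T t) by exact: levT.
  have hTT : lev n (T (T t)) by exact: levTn.
  apply: addr_ge0.
    rewrite mulr_ge0 ?sqr_ge0//; apply: (IHn _ _).1.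
    by apply: levD; [exact: levZ|rewrite -scaleNr; exact: levZ].
  apply: addr_ge0; last by rewrite mulr_ge0 ?sqr_ge0// ltW.
  apply: mulr_ge0; first exact: ltW.
  apply: addr_ge0.
    apply: (IHn _ _).1; rewrite !Texp.
    by apply: levD; [exact: levZ|rewrite -scaleN1r; exact: levZ].
  by rewrite mulr_ge0//; [lra|exact: (IHn _ _).2].
split; first exact: Bn1.
have [|v hv] := solve_unipotent (p := (2 * g0)^-1) (q := 0) _ (levZ (2 * g0)^-1 hu).
  rewrite mul0r addr0 mulrC; apply/eqP => /(canRL (mulfVK _)) => h.
  by move: gw; rewrite h ?mul1r ?subrr ?ltxx//; apply/eqP; lra.
rewrite scale0r addr0 => /(congr1 (fun t => (2 * g0) *: t)).
rewrite scalerBr !scalerA divff ?scale1r; last by apply/eqP; lra.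
move=> <-; rewrite -/(G v) -(pmulr_rge0 _ be0) id1.
apply: addr_ge0; first by rewrite mulr_ge0 ?(ltW be0)//; apply: (IHn _ _).2; exact: levT.
rewrite mulr_ge0//; first lra.
apply: addr_ge0; first exact: sqr_ge0.
rewrite mulr_ge0 ?(ltW be0)//; apply: Bn1.
by apply: levD; [exact: levZ|rewrite -scaleN1r; apply: levZ; exact: levTn].
Qed.

End AbstractPositivity.

(** The symmetry T -> -T, w -> -w, a -> -a preserves the kernel equation and P'(w), which reduces a
    < 0 to a > 0. *)
Lemma psd_of_neg (R : realType) (E : lmodType R) (T : {linear E -> E})
    (B : E -> E -> R) (eps : E -> R) (lev : nat -> E -> Prop) (w a b : R) :
  (forall u v, B u v = B v u) ->
  (forall k u v x, B (k *: u + v) x = k * B u x + B v x) ->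
  (forall n k u v, lev n u -> lev n v -> lev n (k *: u + v)) ->
  (forall n u, lev n u -> lev n.+1 u) ->
  (forall n u, lev n.+1 u -> lev n (T u)) ->
  (forall u, lev 0 u -> T u = w *: u) ->
  (forall u, lev 0 u -> 0 <= B u u) ->
  (forall u v,
    B u v - a * (B (T u) v + B u (T v))
          - b * (B (T (T u)) v + B (T u) (T v) + B u (T (T v))) = eps u * eps v) ->
  0 < 1 - 2 * a * w - 3 * b * w ^+ 2 ->
  b < 0 -> 0 <= a ^+ 2 + 3 * b -> 0 < a * (a + 3 * b * w) ->
  forall n u, lev n u -> 0 <= B u u.
Proof.
move=> BC BL levL levS levT lev0T lev0B Nid Nw b0 ab aaw n u hu.
have [a0|a0|a0] := ltgtP 0 a; last by move: aaw; rewrite -a0 mul0r ltxx.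
  move: hu; apply: (psd_of_neg_gt0 BC BL levL levS levT lev0T lev0B Nid) => //.
  by move: aaw; rewrite pmulr_rgt0.
have B0l x : B 0 x = 0.
  have := BL 1 0 0 x; rewrite scaler0 addr0 mul1r => /eqP.
  by rewrite -subr_eq0 opprD addrA subrr add0r oppr_eq0 => /eqP.
have BN x y : B (- x) y = - B x y.
  by rewrite -[- x]addr0 -scaleN1r BL B0l addr0 mulN1r.
have BNr x y : B x (- y) = - B x y by rewrite BC BN BC.
have lev_0 m x : lev m x -> lev m 0.
  by move=> h; have := levL m (-1) x x h h; rewrite scaleN1r addNr.
pose S : {linear E -> E} := (-%R \o T).
have SE x : S x = - T x by [].
have SSE x : S (S x) = T (T x) by rewrite !SE linearN opprK.
move: hu; apply: (@psd_of_neg_gt0 _ _ S B eps lev (- w) BC BL levL levS _ _ lev0B (- a) b).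
- move=> m x h; rewrite SE -scaleN1r -[_ *: _]addr0.
  by apply: levL; [exact: levT|exact: lev_0 (levT _ _ h)].
- by move=> x h; rewrite SE lev0T// scaleNr.
- by move=> x y; rewrite !SSE !SE !BN !BNr -Nid; ring.
- rewrite (_ : 1 - 2 * - a * - w - 3 * b * (- w) ^+ 2 =
    1 - 2 * a * w - 3 * b * w ^+ 2) //.
  by ring.
- by [].
- by rewrite sqrrN.
- by rewrite oppr_gt0.
- move: aaw; rewrite nmulr_rgt0// -oppr_gt0.
  by rewrite opprD mulrN.
Qed.

(** * Adjoining a formal resolvent *)

Section ExtendedPositivity.
Variables (R : realType) (a b w : R).
Local Notation c := (c a b).
Local Notation T := (shiftT a b).
Let kap := 1 - 2 * a * w - 3 * b * w ^+ 2.
Hypothesis kap0 : 0 < kap.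

Let E := ({poly R} * R^o)%type.

(* The pair (u, l) stands for the function N u + l / (1 - z t) of t, where
   z = w - a w^2 - b w^3 and N = 1 - a (T + w) - b (T^2 + w T + w^2). *)
Let extT (x : E) : E := (T x.1, w *: x.2).

Let extT_is_linear : linear extT.
Proof.
move=> k x y; apply: injective_projections => /=; first exact: linearP.
by rewrite /GRing.scale/=; ring.
Qed.

HB.instance Definition _ := GRing.isLinear.Build R E E *:%R extT extT_is_linear.

(** N(T, w) = (P(T) - P(w)) / (T - w). For vectors of the form N u the pairing with the resolvent is
    a finite expression in u. *)
Let Nop (u : {poly R}) : {poly R} :=
  u - a *: (T u + w *: u) - b *: (T (T u) + w *: T u + w ^+ 2 *: u).

Let TD u v : T (u + v) = T u + T v. Proof. exact: linearD. Qed.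
Let TN u : T (- u) = - T u. Proof. exact: linearN. Qed.
Let TZ k u : T (k *: u) = k *: T u. Proof. exact: linearZ. Qed.

Let NopL k u v : Nop (k *: u + v) = k *: Nop u + Nop v.
Proof. by rewrite /Nop !(TD, TZ) -!mul_polyC; ring. Qed.

Let NopT u : Nop (T u) = T (Nop u).
Proof. by rewrite /Nop !(TD, TN, TZ). Qed.

(** For q = 1 / (1 - z t) with T q = w q, the kernel equation forces L((N u) q) = u(0) and L(q^2) =
    1 / P'(w); these values are taken as the definition. *)
Let extB (x y : E) : R := mom c (Nop x.1 * Nop y.1)
  + (x.2 : R) * y.1`_0 + (y.2 : R) * x.1`_0 + (x.2 : R) * (y.2 : R) / kap.

Let exteps (x : E) : R := (Nop x.1)`_0 + x.2.

Let extN x y : extB x y - a * (extB (extT x) y + extB x (extT y))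
  - b * (extB (extT (extT x)) y + extB (extT x) (extT y) + extB x (extT (extT y)))
  = exteps x * exteps y.
Proof.
case: x y => [u l] [v m]; rewrite /extB /exteps /= !NopT /GRing.scale/=.
have -> : ((Nop u)`_0 + l) * ((Nop v)`_0 + m) =
    (Nop u)`_0 * (Nop v)`_0 + (l * (Nop v)`_0 + m * (Nop u)`_0 + l * m) by ring.
have NE x : (Nop x)`_0 = x`_0 - a * ((T x)`_0 + w * x`_0)
    - b * ((T (T x))`_0 + w * (T x)`_0 + w ^+ 2 * x`_0).
  by rewrite /Nop !(coefD, coefN, coefZ).
have K := momM_kernel a b (Nop u) (Nop v); cbv beta zeta in K.
rewrite -[X in _ = X + _]K !NE.
by move: (kap0) => /lt0r_neq0; rewrite /kap => k0; field.
Qed.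

Hypothesis wP : 0 < b \/ [/\ b < 0, 0 <= a ^+ 2 + 3 * b & 0 < a * (a + 3 * b * w)].

(** On (u, l) with N u = p (1 - z X) and u(0) = L(p), the extended form is L(p^2 (1 - z X)^2) + 2 l
    L(p) + l^2 / P'(w). Its minimum over l, at l = - P'(w) L(p), is nonnegative. *)
Lemma mom_resolvent_le p z : z = w - a * w ^+ 2 - b * w ^+ 3 ->
  mom c p ^+ 2 * kap <= mom c ((p * (1 - z *: 'X)) ^+ 2).
Proof.
move=> zE; pose lev n (x : E) := (size x.1 <= n)%N.
have psd x : 0 <= extB x x.
  have BC x1 x2 : extB x1 x2 = extB x2 x1.
    by rewrite /extB [Nop x1.1 * _]mulrC; ring.
  have BL k x1 x2 x3 : extB (k *: x1 + x2) x3 = k * extB x1 x3 + extB x2 x3.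
    rewrite /extB /= NopL mulrDl -scalerAl linearP coefD coefZ /GRing.scale/=.
    by field; exact: lt0r_neq0.
  have levL n k x1 x2 : lev n x1 -> lev n x2 -> lev n (k *: x1 + x2).
    move=> h1 h2; rewrite /lev/= (leq_trans (size_polyD _ _))// geq_max.
    by rewrite (leq_trans (size_scale_leq _ _)).
  have levS n x1 : lev n x1 -> lev n.+1 x1 by exact: leqW.
  have levT n x1 : lev n.+1 x1 -> lev n (extT x1) by exact: size_shiftT.
  have lev0T x1 : lev 0%N x1 -> extT x1 = w *: x1.
    case: x1 => u l; rewrite /lev/= leqn0 size_poly_eq0 => /eqP ->.
    by apply: injective_projections => //=; rewrite linear0 scaler0.
  have lev0B x1 : lev 0%N x1 -> 0 <= extB x1 x1.
    case: x1 => u l; rewrite /lev/= leqn0 size_poly_eq0 => /eqP ->.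
    rewrite /extB/= coef0 mulr0 !addr0.
    have -> : Nop 0 = 0 by rewrite /Nop !linear0 !(scaler0, addr0, subr0).
    by rewrite mul0r linear0 add0r -expr2 divr_ge0 ?sqr_ge0// ltW.
  case: wP => [b0|[b0 ab aw]].
    exact: (psd_of_pos BC BL levL levS levT lev0T lev0B extN kap0 b0 (leqnn (size x.1))).
  exact: (psd_of_neg BC BL levL levS levT lev0T lev0B extN kap0 b0 ab aw (leqnn (size x.1))).
(* N (T - w) = P(T) - P(w) = V - z, hence N u = (V - z) (X p) = p - z X p. *)
pose u : {poly R} := T ('X * p) - w *: ('X * p).
have Nu : Nop u = p * (1 - z *: 'X).
  have h := shiftT_eq a b ('X * p); rewrite drop1X in h.
  have -> : p = T ('X * p) - a *: T (T ('X * p)) - b *: T (T (T ('X * p))).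
    by rewrite {1}h; ring.
  rewrite /Nop /u !(TD, TN, TZ).
  have -> : (T ('X * p) - a *: T (T ('X * p)) - b *: T (T (T ('X * p)))) * (1 - z *: 'X)
    = T ('X * p) - a *: T (T ('X * p)) - b *: T (T (T ('X * p))) - z *: ('X * p).
    have -> : T ('X * p) - a *: T (T ('X * p)) - b *: T (T (T ('X * p))) = p.
      by rewrite {1}h; ring.
    by rewrite -!mul_polyC; ring.
  by rewrite zE -!mul_polyC !(rmorphB, rmorphD, rmorphM, rmorphXn)/=; ring.
have u0 : u`_0 = mom c p.
  by rewrite -[in RHS](drop1X p) mom_drop /u coefB coefZ coefXM/= mulr0 subr0.
have := psd (u, - (mom c p * kap)).
rewrite /extB/= Nu u0 -expr2.
have -> : mom c ((p * (1 - z *: 'X)) ^+ 2) + - (mom c p * kap) * mom c p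
  + - (mom c p * kap) * mom c p + - (mom c p * kap) * - (mom c p * kap) / kap =
  mom c ((p * (1 - z *: 'X)) ^+ 2) - mom c p ^+ 2 * kap.
  by field; exact: lt0r_neq0.
by rewrite subr_ge0.
Qed.

End ExtendedPositivity.

(** At w = 0 the resolvent inequality reads L(p)^2 <= L(p^2). *)
Lemma mom_sqr_ge0 (R : realType) (a b : R) p : b != 0 -> 0 <= a ^+ 2 + 3 * b ->
  0 <= mom (c a b) (p ^+ 2).
Proof.
move=> b0 ab; have z0 : 0 = 0 - a * 0 ^+ 2 - b * 0 ^+ 3 :> R by ring.
have := fun k w => @mom_resolvent_le R a b 0 k w p 0 z0.
rewrite scale0r subr0 mulr1 => h; apply: le_trans (h _ _).
- by rewrite expr0n/= !mulr0 !subr0 mulr1 sqr_ge0.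
- by rewrite expr0n/= !mulr0 !subr0.
- have [b1|b1] := ltP 0 b; [by left|right].
  have b2 : b < 0 by rewrite lt_neqAle b0.
  by split=> //; rewrite mulr0 addr0 -expr2; lra.
Qed.

(** * Propagation of positivity along the real line *)

Section ShiftedKernels.
Variables (R : realType).
Implicit Types (k : nat -> nat -> R) (i j m n N : nat) (h M K : R).

(** Multiplication by x, and in [shr] by y, of the double power series with coefficients [k]. *)
Definition shl k m n : R := if m is m'.+1 then k m' n else 0.
Definition shr k m n : R := if n is n'.+1 then k m n' else 0.

(* k is the coefficient array of 1 / (al - ga (x + y) - b (x^2 + x y + y^2)). *)
Definition inverse_kernel (al ga b : R) k := forall m n,
  al * k m n - ga * (shl k m n + shr k m n)
  - b * (shl (shl k) m n + shl (shr k) m n + shr (shr k) m n)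
  = ((m == 0%N) && (n == 0%N))%:R.

Definition psd_array k := forall N (v : nat -> R),
  0 <= \sum_(i < N) \sum_(j < N) v i * v j * k i j.

Definition geom_bounded M k := exists2 K, 0 <= K & forall m n, `|k m n| <= K * M ^+ (m + n).

Lemma geom_bounded_shl M k : 1 <= M -> geom_bounded M k -> geom_bounded M (shl k).
Proof.
move=> M1 [K K0 kK]; have M0 : 0 <= M by apply: le_trans M1.
exists K => // -[|m] n /=; first by rewrite normr0 mulr_ge0// exprn_ge0.
by rewrite (le_trans (kK _ _))// ler_wpM2l// ler_weXn2l// addSn.
Qed.

Lemma geom_bounded_shr M k : 1 <= M -> geom_bounded M k -> geom_bounded M (shr k).
Proof.
move=> M1 [K K0 kK]; have M0 : 0 <= M by apply: le_trans M1.
exists K => // m [|n] /=; first by rewrite normr0 mulr_ge0// exprn_ge0.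
by rewrite (le_trans (kK _ _))// ler_wpM2l// ler_weXn2l// addnS.
Qed.

(** The recursion expresses al k m n by two entries with factor ga and three with factor b, all of
    smaller total degree. The rate M depends only on bounds for al, ga and b, so one step length can
    serve a whole chain of kernels. *)
Lemma inverse_kernel_bounded al ga b k M : 0 < al -> 1 <= M ->
  2 * `|ga| + 3 * `|b| <= al * M -> inverse_kernel al ga b k -> geom_bounded M k.
Proof.
move=> al0 M1 h rec; have M0 : 0 < M by apply: lt_le_trans M1.
exists al^-1; first by rewrite invr_ge0 ltW.
suff: forall s m n, (m + n < s)%N -> `|k m n| <= al^-1 * M ^+ (m + n).
  by move=> H m n; exact: (H (m + n).+1).
elim=> // s IHs m n; rewrite ltnS => mns.
rewrite -(ler_pM2l al0) mulrA divff ?lt0r_neq0// mul1r.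
rewrite -[X in X * `|_|]gtr0_norm// -normrM.
have [/andP[/eqP m0 /eqP n0]|mn0] := boolP ((m == 0%N) && (n == 0%N)).
  by have := rec m n; rewrite m0 n0/= addr0 mulr0 !addr0 mulr0 !subr0 => ->; rewrite normr1.
have mn : (0 < m + n)%N by rewrite lt0n addn_eq0.
have -> : al * k m n = ga * (shl k m n + shr k m n)
  + b * (shl (shl k) m n + shl (shr k) m n + shr (shr k) m n).
  by have := rec m n; rewrite (negPf mn0) => /eqP; rewrite -addrA -opprD subr_eq0 => /eqP.
pose Y := al^-1 * M ^+ (m + n).-1.
have MN0 e : 0 <= M ^+ e by rewrite exprn_ge0// ltW.
have Y0 : 0 <= Y by rewrite mulr_ge0// invr_ge0 ltW.
have IH' m' n' : (m' + n' < m + n)%N -> `|k m' n'| <= Y.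
  move=> lt_mn; rewrite (le_trans (IHs _ _ _))//; first exact: leq_trans lt_mn mns.
  by rewrite ler_wpM2l ?invr_ge0 ?(ltW al0)// ler_weXn2l// -ltnS (prednK mn).
have [h1 h2 h3 h4 h5] : [/\ `|shl k m n| <= Y, `|shr k m n| <= Y,
    `|shl (shl k) m n| <= Y, `|shl (shr k) m n| <= Y & `|shr (shr k) m n| <= Y].
  move: IH'; clearbody Y; clear -Y0 => H; split.
  - by case: m H => [|m] H; rewrite /= ?normr0//; apply: H; rewrite addSn.
  - by case: n H => [|n] H; rewrite /= ?normr0//; apply: H; rewrite addnS.
  - by case: m H => [|[|m]] H; rewrite /= ?normr0//; apply: H; rewrite !addSn.
  - by case: m n H => [|m] [|n] H; rewrite /= ?normr0//; apply: H; rewrite addSn addnS.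
  - by case: n H => [|[|n]] H; rewrite /= ?normr0//; apply: H; rewrite !addnS.
apply: (@le_trans _ _ (`|ga| * (Y + Y) + `|b| * (Y + Y + Y))).
  apply: (le_trans (ler_normD _ _)); rewrite !normrM; apply: lerD.
    by rewrite ler_wpM2l// (le_trans (ler_normD _ _))// lerD.
  rewrite ler_wpM2l// (le_trans (ler_normD _ _))// lerD//.
  by rewrite (le_trans (ler_normD _ _))// lerD.
have -> : `|ga| * (Y + Y) + `|b| * (Y + Y + Y) = (2 * `|ga| + 3 * `|b|) * Y by ring.
have -> : M ^+ (m + n) = (al * M) * Y.
  rewrite /Y -{1}(prednK mn) exprS; field; exact: lt0r_neq0.
by rewrite ler_wpM2r.
Qed.

(** Coefficient of x^i in (x + h)^m; for i > m the binomial vanishes, so the truncated m - i is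
    harmless. *)
Definition taylor_weight h i m : R := 'C(m, i)%:R * h ^+ (m - i).

Lemma taylor_weightS0 h m : taylor_weight h 0 m.+1 = h * taylor_weight h 0 m.
Proof. by rewrite /taylor_weight !bin0 !mul1r !subn0 exprS. Qed.

Lemma taylor_weightS h i m :
  taylor_weight h i.+1 m.+1 = h * taylor_weight h i.+1 m + taylor_weight h i m.
Proof.
rewrite /taylor_weight binS natrD mulrDl subSS; congr (_ + _).
have [im|im] := ltnP i m; last by rewrite bin_small ?ltnS// !mul0r mulr0.
by rewrite mulrCA -exprS subnSK.
Qed.

Lemma taylor_weight_bound h H i m : 0 < H -> `|h| <= H ->
  `|taylor_weight h i m| <= (H ^+ i)^-1 * (2 * H) ^+ m.
Proof.
move=> H0 hH; rewrite /taylor_weight normrM normrX ger0_norm ?ler0n//.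
have [im|im] := leqP i m; last first.
  by rewrite bin_small// mul0r mulr_ge0 ?invr_ge0 ?exprn_ge0 ?mulr_ge0 ?(ltW H0).
rewrite exprMn mulrCA; apply: ler_pM; rewrite ?ler0n ?exprn_ge0//.
  rewrite -natrX ler_nat -[2%N]/(1 + 1)%N expnDn.
  rewrite (bigD1 (Ordinal (im : (i < m.+1)%N)))//=.
  by rewrite !exp1n !muln1 leq_addr.
rewrite -(subnK im) exprD mulrC -mulrA mulfV ?mulr1 ?addnK; last first.
  by rewrite expf_neq0// lt0r_neq0.
by rewrite lerXn2r// nnegrE// ltW.
Qed.

(** Partial sum of the coefficient of x^i y^j in K(x + h, y + h). *)
Definition taylor_sum h k N i j : R := \sum_(m < N.+1) \sum_(n < N.+1)
  taylor_weight h i m * taylor_weight h j n * k m n.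

Lemma taylor_sum_tr h k N i j :
  taylor_sum h k N i j = taylor_sum h (fun m n => k n m) N j i.
Proof.
rewrite /taylor_sum exchange_big; apply: eq_bigr => m _; apply: eq_bigr => n _.
by rewrite (mulrC (taylor_weight h i _)).
Qed.

Lemma sum_half_le N : \sum_(n < N) (2^-1 : R) ^+ n <= 2.
Proof.
suff -> : \sum_(n < N) (2^-1 : R) ^+ n = 2 - 2 * 2^-1 ^+ N.
  by rewrite gerBl mulr_ge0// exprn_ge0// invr_ge0.
elim: N => [|N IHN]; first by rewrite big_ord0 expr0 mulr1 subrr.
by rewrite big_ord_recr/= IHN exprS; field.
Qed.

(** Re-expansion at h turns the factor x into x + h, by Pascal's rule. Truncation leaves an error
    only in the row m = N, of order 2^-N by the bound on h. *)
Lemma taylor_sum_shl h k M i j : 1 <= M -> `|h| <= (4 * M)^-1 -> geom_bounded M k ->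
  (fun N => taylor_sum h (shl k) N i j -
     (h * taylor_sum h k N i j + shl (taylor_sum h k N) i j)) @ \oo --> (0 : R).
Proof.
move=> M1 hM [K K0 kK]; have M0 : 0 < M by apply: lt_le_trans M1.
have H0 : 0 < (4 * M)^-1 by rewrite invr_gt0 mulr_gt0.
set H := (4 * M)^-1 in H0 hM.
have HM : 2 * H * M = 2^-1 by rewrite /H; field; exact: lt0r_neq0.
have err N : taylor_sum h (shl k) N i j -
     (h * taylor_sum h k N i j + shl (taylor_sum h k N) i j) =
  - (taylor_weight h i N.+1 * \sum_(n < N.+1) taylor_weight h j n * k N n).
  have -> : taylor_sum h (shl k) N i j =
    \sum_(m < N) \sum_(n < N.+1) taylor_weight h i m.+1 * taylor_weight h j n * k m n.
    rewrite /taylor_sum big_ord_recl/= big1 ?add0r; last by move=> n _; rewrite mulr0.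
    by apply: eq_bigr => m _; rewrite /bump/= add1n.
  have -> : h * taylor_sum h k N i j + shl (taylor_sum h k N) i j =
    \sum_(m < N.+1) \sum_(n < N.+1) taylor_weight h i m.+1 * taylor_weight h j n * k m n.
    case: i => [|i] /=.
      rewrite addr0 /taylor_sum mulr_sumr; apply: eq_bigr => m _.
      by rewrite mulr_sumr; apply: eq_bigr => n _; rewrite taylor_weightS0 !mulrA.
    rewrite /taylor_sum mulr_sumr -big_split/=; apply: eq_bigr => m _.
    rewrite mulr_sumr -big_split/=; apply: eq_bigr => n _.
    by rewrite taylor_weightS; ring.
  rewrite big_ord_recr/= opprD addrA subrr add0r mulr_sumr; congr (- _).
  by apply: eq_bigr => n _; rewrite mulrA.
pose C := (H ^+ i)^-1 * (2 * H) * ((H ^+ j)^-1 * K * 2).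
apply/cvgrPdist_le => e e0; near=> N.
rewrite sub0r normrN err normrN normrM.
apply: (@le_trans _ _ (C * 2^-1 ^+ N)); last first.
  near: N; have : (fun N => C * 2^-1 ^+ N) @ \oo --> C * (0 : R).
    apply: cvgM; first exact: cvg_cst.
    by apply: cvg_expr; rewrite gtr0_norm ?invr_gt0// invf_lt1// ltr1n.
  rewrite mulr0 => /cvgrPdist_le /(_ e e0); apply: filterS => N.
  by rewrite sub0r normrN => /(le_trans (ler_norm _)).
have -> : C * 2^-1 ^+ N =
  ((H ^+ i)^-1 * (2 * H) ^+ N.+1) * (M ^+ N * ((H ^+ j)^-1 * K * 2)).
  by rewrite /C -HM [(_ * M) ^+ N]exprMn exprS; ring.
apply: ler_pM => //; first exact: taylor_weight_bound.
apply: (le_trans (ler_norm_sum _ _ _)).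
apply: (@le_trans _ _ (M ^+ N * ((H ^+ j)^-1 * K * \sum_(n < N.+1) 2^-1 ^+ n))).
  rewrite !mulr_sumr; apply: ler_sum => n _; rewrite normrM.
  have -> : M ^+ N * ((H ^+ j)^-1 * K * 2^-1 ^+ n) =
    ((H ^+ j)^-1 * (2 * H) ^+ n) * (K * M ^+ (N + n)).
    by rewrite -HM exprMn exprD; ring.
  by apply: ler_pM => //; exact: taylor_weight_bound.
rewrite ler_wpM2l ?exprn_ge0 ?(ltW M0)// ler_wpM2l ?sum_half_le// mulr_ge0//.
by rewrite invr_ge0 exprn_ge0// ltW.
Unshelve. all: by end_near. Qed.

Lemma taylor_sum_shr h k M i j : 1 <= M -> `|h| <= (4 * M)^-1 -> geom_bounded M k ->
  (fun N => taylor_sum h (shr k) N i j -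
     (h * taylor_sum h k N i j + shr (taylor_sum h k N) i j)) @ \oo --> (0 : R).
Proof.
move=> M1 hM [K K0 kK].
have bk : geom_bounded M (fun m n => k n m) by exists K => // m n; rewrite addnC.
have := @taylor_sum_shl h _ M j i M1 hM bk; apply: cvg_trans; apply: near_eq_cvg.
near=> N; rewrite /= [in RHS]taylor_sum_tr [taylor_sum h k N i j]taylor_sum_tr.
by congr (_ - (_ + _)); case: j => //= j'; rewrite taylor_sum_tr.
Unshelve. all: by end_near. Qed.

End ShiftedKernels.

Section TaylorShift.
Variables (R : realType).
Implicit Types (k : nat -> nat -> R) (i j m n N : nat) (h M K : R).

Lemma cvg_sumr (X J : Type) (F : set_system X) (s : seq J) (P : pred J)
    (f : J -> X -> R) (l : J -> R) : Filter F ->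
  (forall e, P e -> f e x @[x --> F] --> l e) ->
  (\sum_(e <- s | P e) f e x) @[x --> F] --> \sum_(e <- s | P e) l e.
Proof. by move=> FF; apply: cvg_big; exact: add_continuous. Qed.

Lemma shl_cvg (k : nat -> nat -> nat -> R) k' i j :
  (forall i' j', (i' + j' < i + j)%N -> k ^~ i' ^~ j' @ \oo --> k' i' j') ->
  (fun N => shl (k N) i j) @ \oo --> shl k' i j.
Proof.
case: i => [|i] H /=; first exact: cvg_cst.
by apply: H; rewrite addSn.
Qed.

Lemma shr_cvg (k : nat -> nat -> nat -> R) k' i j :
  (forall i' j', (i' + j' < i + j)%N -> k ^~ i' ^~ j' @ \oo --> k' i' j') ->
  (fun N => shr (k N) i j) @ \oo --> shr k' i j.
Proof.
case: j => [|j] H /=; first exact: cvg_cst.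
by apply: H; rewrite addnS.
Qed.

(** The new constants come from substituting x + h and y + h in the denominator of the kernel. Only
    the combination is shown to converge here; convergence of the single entries is deduced from
    it. *)
Lemma taylor_sum_inverse_kernel h k M (al ga b : R) i j : 1 <= M -> `|h| <= (4 * M)^-1 ->
  geom_bounded M k -> inverse_kernel al ga b k ->
  let S N := taylor_sum h k N in
  (fun N => (al - 2 * ga * h - 3 * b * h ^+ 2) * S N i j
    - (ga + 3 * b * h) * (shl (S N) i j + shr (S N) i j)
    - b * (shl (shl (S N)) i j + shl (shr (S N)) i j + shr (shr (S N)) i j))
  @ \oo --> (((i == 0%N) && (j == 0%N))%:R : R).
Proof.
move=> M1 hM kM rec S.
have bl := geom_bounded_shl M1 kM; have br := geom_bounded_shr M1 kM.
have el i' j' := taylor_sum_shl i' j' M1 hM kM.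
have er i' j' := taylor_sum_shr i' j' M1 hM kM.
have ell := taylor_sum_shl i j M1 hM bl.
have elr := taylor_sum_shl i j M1 hM br.
have err := taylor_sum_shr i j M1 hM br.
have ell' : (fun N => shl (taylor_sum h (shl k) N) i j -
    (h * shl (S N) i j + shl (shl (S N)) i j)) @ \oo --> (0 : R).
  case: i {ell elr err} => [|i] /=; last exact: el.
  by under eq_fun do rewrite mulr0 addr0 subrr; exact: cvg_cst.
have elr' : (fun N => shl (taylor_sum h (shr k) N) i j -
    (h * shl (S N) i j + shl (shr (S N)) i j)) @ \oo --> (0 : R).
  case: i {ell elr err ell'} => [|i] /=; last exact: er.
  by under eq_fun do rewrite mulr0 addr0 subrr; exact: cvg_cst.
have err' : (fun N => shr (taylor_sum h (shr k) N) i j -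
    (h * shr (S N) i j + shr (shr (S N)) i j)) @ \oo --> (0 : R).
  case: j {ell elr err ell' elr'} => [|j] /=; last exact: er.
  by under eq_fun do rewrite mulr0 addr0 subrr; exact: cvg_cst.
(* The recursion survives truncation exactly when the arrays are shifted before the re-expansion. *)
have exact_sum N : al * S N i j
    - ga * (taylor_sum h (shl k) N i j + taylor_sum h (shr k) N i j)
    - b * (taylor_sum h (shl (shl k)) N i j + taylor_sum h (shl (shr k)) N i j
           + taylor_sum h (shr (shr k)) N i j) = ((i == 0%N) && (j == 0%N))%:R.
  transitivity (\sum_(m < N.+1) \sum_(n < N.+1)
      taylor_weight h i m * taylor_weight h j n * ((m == 0%N :> nat) && (n == 0%N :> nat))%:R).
    rewrite /S /taylor_sum -!big_split/= !mulr_sumr -!sumrB; apply: eq_bigr => m _.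
    rewrite -!big_split/= !mulr_sumr -!sumrB; apply: eq_bigr => n _.
    by rewrite -rec; ring.
  rewrite big_ord_recl/= big_ord_recl/= mulr1 big1 ?addr0; last by move=> n _; rewrite mulr0.
  rewrite big1 ?addr0; last by move=> m _; rewrite big1// => n _; rewrite mulr0.
  rewrite /taylor_weight !bin0n !sub0n !expr0 !mulr1 -natrM mulnb.
  by rewrite !bin_small || case: i j {ell elr err ell' elr' err'} => [|i] [|j].
pose u N := ((i == 0%N) && (j == 0%N))%:R +
  (ga * ((taylor_sum h (shl k) N i j - (h * S N i j + shl (S N) i j))
     + (taylor_sum h (shr k) N i j - (h * S N i j + shr (S N) i j)))
   + b * ((taylor_sum h (shl (shl k)) N i j
         - (h * taylor_sum h (shl k) N i j + shl (taylor_sum h (shl k) N) i j))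
      + h * (taylor_sum h (shl k) N i j - (h * S N i j + shl (S N) i j))
      + (shl (taylor_sum h (shl k) N) i j - (h * shl (S N) i j + shl (shl (S N)) i j))
      + (taylor_sum h (shl (shr k)) N i j
         - (h * taylor_sum h (shr k) N i j + shl (taylor_sum h (shr k) N) i j))
      + h * (taylor_sum h (shr k) N i j - (h * S N i j + shr (S N) i j))
      + (shl (taylor_sum h (shr k) N) i j - (h * shl (S N) i j + shl (shr (S N)) i j))
      + (taylor_sum h (shr (shr k)) N i j
         - (h * taylor_sum h (shr k) N i j + shr (taylor_sum h (shr k) N) i j))
      + h * (taylor_sum h (shr k) N i j - (h * S N i j + shr (S N) i j))
      + (shr (taylor_sum h (shr k) N) i j - (h * shr (S N) i j + shr (shr (S N)) i j)))).
suff : u @ \oo --> (((i == 0%N) && (j == 0%N))%:R + 0 : R).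
  rewrite addr0; apply: cvg_trans; apply: near_eq_cvg; near=> N.
  by rewrite /u -(exact_sum N); ring.
apply: cvgD; first exact: cvg_cst.
have Z (r : R) (f : nat -> R) : f @ \oo --> (0 : R) -> (fun N => r * f N) @ \oo --> (0 : R).
  by move=> u0; rewrite -[X in _ --> X](mulr0 r); apply: cvgM => //; exact: cvg_cst.
have A (f g : nat -> R) : f @ \oo --> (0 : R) -> g @ \oo --> (0 : R) ->
    (fun N => f N + g N) @ \oo --> (0 : R).
  by move=> u0 v0; rewrite -[X in _ --> X](addr0 0); exact: cvgD.
apply: (A); apply: (Z); first by apply: (A); [exact: el|exact: er].
apply: (A); last exact: err'.
apply: (A); last by apply: (Z); exact: er.
apply: (A); last exact: err.
apply: (A); last exact: elr'.
apply: (A); last by apply: (Z); exact: er.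
apply: (A); last exact: elr.
apply: (A); last exact: ell'.
by apply: (A); [exact: ell|apply: (Z); exact: el].
Unshelve. all: by end_near. Qed.

Lemma inverse_kernel_shift h k M al ga b : 1 <= M -> `|h| <= (4 * M)^-1 ->
  geom_bounded M k -> inverse_kernel al ga b k -> psd_array k ->
  al - 2 * ga * h - 3 * b * h ^+ 2 != 0 ->
  exists2 k', psd_array k' &
    inverse_kernel (al - 2 * ga * h - 3 * b * h ^+ 2) (ga + 3 * b * h) b k'.
Proof.
move=> M1 hM kM rec psd al0; pose S N := taylor_sum h k N.
have E i j := @taylor_sum_inverse_kernel h k M al ga b i j M1 hM kM rec.
set al' := al - _ - _ in al0 E *; set ga' := ga + _ in E *.
pose k' i j := lim ((fun N => S N i j) @ \oo).
(* The limit relation determines al' S N i j from entries of smaller total degree, so the limits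
   exist by induction on i + j. *)
have cvk : forall s i j, (i + j < s)%N -> (fun N => S N i j) @ \oo --> k' i j.
  elim=> // s IHs i j; rewrite ltnS => ijs.
  have H i' j' : (i' + j' < i + j)%N -> (fun N => S N i' j') @ \oo --> k' i' j'.
    by move=> lt; apply: IHs; exact: leq_trans ijs.
  have hl := shl_cvg H; have hr := shr_cvg H.
  have hll : (fun N => shl (shl (S N)) i j) @ \oo --> shl (shl k') i j.
    by apply: shl_cvg => i' j' lt; apply: shl_cvg => i2 j2 lt2; apply: H; exact: ltn_trans lt.
  have hlr : (fun N => shl (shr (S N)) i j) @ \oo --> shl (shr k') i j.
    by apply: shl_cvg => i' j' lt; apply: shr_cvg => i2 j2 lt2; apply: H; exact: ltn_trans lt.
  have hrr : (fun N => shr (shr (S N)) i j) @ \oo --> shr (shr k') i j.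
    by apply: shr_cvg => i' j' lt; apply: shr_cvg => i2 j2 lt2; apply: H; exact: ltn_trans lt.
  suff : (fun N => S N i j) @ \oo --> (al'^-1 * (((i == 0%N) && (j == 0%N))%:R
    + ga' * (shl k' i j + shr k' i j)
    + b * (shl (shl k') i j + shl (shr k') i j + shr (shr k') i j)) : R) by move/cvgP.
  have -> : (fun N => S N i j) = (fun N => al'^-1 * ((al' * S N i j
    - ga' * (shl (S N) i j + shr (S N) i j)
    - b * (shl (shl (S N)) i j + shl (shr (S N)) i j + shr (shr (S N)) i j))
    + ga' * (shl (S N) i j + shr (S N) i j)
    + b * (shl (shl (S N)) i j + shl (shr (S N)) i j + shr (shr (S N)) i j))).
    by apply/funext => N; rewrite -addrA -addrA addrA; field.
  apply: cvgM; first exact: cvg_cst.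
  apply: cvgD; first apply: cvgD; first exact: E.
    by apply: cvgM; [exact: cvg_cst|exact: cvgD].
  by apply: cvgM; [exact: cvg_cst|apply: cvgD => //; exact: cvgD].
have cvk' i j : (fun N => S N i j) @ \oo --> k' i j by apply: (cvk (i + j).+1).
exists k'.
  (* The truncated re-expansion is a congruence of [k] by the matrix of Taylor weights, hence
     positive already before the limit. *)
  move=> N v; pose u m := \sum_(i < N) v i * taylor_weight h i m.
  have : (fun n => \sum_(i < N) \sum_(j < N) v i * v j * S n i j) @ \oo -->
      \sum_(i < N) \sum_(j < N) v i * v j * k' i j.
    apply: cvg_sumr => i _; apply: cvg_sumr => j _.
    by apply: cvgM; [exact: cvg_cst|exact: cvk'].
  move/cvgr_to_ge; apply.
  near=> n; have := psd n.+1 u; congr (0 <= _).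
  transitivity (\sum_(m < n.+1) \sum_(p < n.+1) \sum_(i < N) \sum_(j < N)
      v i * v j * (taylor_weight h i m * taylor_weight h j p * k m p)).
    apply: eq_bigr => m _; apply: eq_bigr => p _; rewrite /u.
    rewrite mulr_suml mulr_suml; apply: eq_bigr => i _.
    rewrite mulr_sumr mulr_suml; apply: eq_bigr => j _; ring.
  under eq_bigr do rewrite exchange_big; rewrite exchange_big; apply: eq_bigr => i _.
  under eq_bigr do rewrite exchange_big; rewrite exchange_big; apply: eq_bigr => j _.
  by rewrite /S /taylor_sum mulr_sumr; apply: eq_bigr => m _; rewrite mulr_sumr.
move=> i j; rewrite -(cvg_lim (@Rhausdorff R) (E i j)); apply/esym/cvg_lim => //.
have hl i' j' : (fun N => shl (S N) i' j') @ \oo --> shl k' i' j' by exact: shl_cvg.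
have hr i' j' : (fun N => shr (S N) i' j') @ \oo --> shr k' i' j' by exact: shr_cvg.
have hll : (fun N => shl (shl (S N)) i j) @ \oo --> shl (shl k') i j by exact: shl_cvg.
have hlr : (fun N => shl (shr (S N)) i j) @ \oo --> shl (shr k') i j by exact: shl_cvg.
have hrr : (fun N => shr (shr (S N)) i j) @ \oo --> shr (shr k') i j by exact: shr_cvg.
apply: cvgB; first apply: cvgB; apply: cvgM; try exact: cvg_cst.
- exact: cvk'.
- exact: cvgD.
- by apply: cvgD => //; exact: cvgD.
Unshelve. all: by end_near. Qed.

End TaylorShift.

(** * Necessity of the discriminant condition *)

Section Necessity.
Variables (R : realType) (a b : R).
Local Notation c := (c a b).
Local Notation T := (shiftT a b).

(** Polynomials e_m with T e_(m+1) = e_m and e_m(0) = [m = 0], so that L(e_m e_n) is the coefficient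
    array of the kernel. The construction works because (1 - a T - b T^2) T = V and V (X e) = e,
    while T kills the subtracted constant. *)
Fixpoint shift_basis m : {poly R} := if m is m'.+1 then
    let q := 'X * shift_basis m' in
    let r := q - a *: T q - b *: T (T q) in r - (r`_0)%:P
  else 1.

Lemma shiftTC r : T r%:P = 0.
Proof.
apply/eqP; rewrite -size_poly_eq0 -leqn0; apply: size_shiftT.
exact: size_polyC_leq1.
Qed.

Lemma shiftT_basis m : T (shift_basis m.+1) = shift_basis m.
Proof.
have TB p q : T (p - q) = T p - T q by exact: linearB.
have TZ k p : T (k *: p) = k *: T p by exact: linearZ.
rewrite /= TB shiftTC subr0 !TB !TZ {1}(shiftT_eq a b (_ * _)) drop1X.
by rewrite -!mul_polyC; ring.
Qed.

Lemma coef0_shift_basis m : (shift_basis m)`_0 = (m == 0%N)%:R.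
Proof. by case: m => [|m]; rewrite /= ?coef1// coefB coefC eqxx subrr. Qed.

Lemma inverse_kernel_basis :
  inverse_kernel 1 a b (fun m n => mom c (shift_basis m * shift_basis n)).
Proof.
pose k m n := mom c (shift_basis m * shift_basis n).
have T0 : T (shift_basis 0) = 0 by exact: (shiftTC 1).
have T00 : T 0 = 0 by exact: linear0.
have kl m n : mom c (T (shift_basis m) * shift_basis n) = shl k m n.
  by case: m => [|m]; rewrite ?T0 ?mul0r ?linear0// shiftT_basis.
have kr m n : mom c (shift_basis m * T (shift_basis n)) = shr k m n.
  by case: n => [|n]; rewrite ?T0 ?mulr0 ?linear0// shiftT_basis.
move=> m n; have := momM_kernel a b (shift_basis m) (shift_basis n).
cbv beta zeta; rewrite !coef0_shift_basis -natrM mulnb => <-.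
rewrite mul1r kl kr; congr (_ - _ - b * (_ + _ + _)).
- by case: m => [|m]; rewrite ?T0 ?T00 ?mul0r ?linear0// shiftT_basis kl.
- by case: m => [|m]; rewrite ?T0 ?T00 ?mul0r ?linear0// shiftT_basis kr.
- by case: n => [|n]; rewrite ?T0 ?T00 ?mulr0 ?linear0// shiftT_basis kr.
Qed.

Lemma discriminant_ge0 : b != 0 -> (forall p, 0 <= mom c (p ^+ 2)) -> 0 <= a ^+ 2 + 3 * b.
Proof.
move=> b0 psd; rewrite leNgt; apply/negP => ab.
have bn : b < 0 by have := sqr_ge0 a; lra.
(* For b < 0, P' has its minimum at w0, and the value de there is positive exactly because a^2 + 3 b
   < 0. *)
pose w0 := - a / (3 * b); pose al w := 1 - 2 * a * w - 3 * b * w ^+ 2.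
pose ga w := a + 3 * b * w.
pose de := (a ^+ 2 + 3 * b) / (3 * b).
have de0 : 0 < de by rewrite nmulr_lgt0// invr_lt0; lra.
have alE w : al w = de - 3 * b * (w - w0) ^+ 2 by rewrite /al /de /w0; field.
have al_de w : de <= al w.
  by rewrite alE lerDl oppr_ge0 nmulr_rle0 ?sqr_ge0//; lra.
(* Along the segment from 0 to w0 one has al >= de, and ga goes linearly from a to 0. Hence one rate
   M serves throughout, and n equal steps of length at most 1 / (4 M) reach w0. *)
pose M := 1 + (2 * `|a| + 3 * `|b|) / de.
have M1 : 1 <= M by rewrite lerDl divr_ge0 ?(ltW de0)// addr_ge0// mulr_ge0.
have M0 : 0 < M by apply: lt_le_trans M1.
have M2 : 2 * `|a| + 3 * `|b| <= de * M.
  by rewrite mulrDr mulr1 mulrCA divff ?lt0r_neq0// mulr1 lerDr ltW.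
pose n := (Num.truncn (4 * M * `|w0|)).+1.
have n0 : n%:R != 0 :> R by rewrite pnatr_eq0.
pose h := w0 / n%:R.
have hM : `|h| <= (4 * M)^-1.
  rewrite normrM normfV [`|n%:R|]ger0_norm ?ler0n// ler_pdivrMr ?ltr0n//.
  rewrite mulrC ler_pdivlMr ?mulr_gt0// mulrC ltW//.
  by rewrite truncnS_gt.
have step j : (j <= n)%N -> exists2 k, psd_array k &
    inverse_kernel (al (j%:R * h)) (ga (j%:R * h)) b k.
  elim: j => [_|j IHj jn].
    exists (fun m n => mom c (shift_basis m * shift_basis n)).
      move=> N v; have := psd (\sum_(i < N) v i *: shift_basis i).
      congr (0 <= _); rewrite expr2 mulr_suml linear_sum; apply: eq_bigr => i _.
      rewrite mulr_sumr linear_sum; apply: eq_bigr => j _.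
      by rewrite -scalerAl -scalerAr scalerA linearZ.
    by rewrite /al /ga mul0r expr0n/= !mulr0 !subr0 addr0; exact: inverse_kernel_basis.
  have [k kpsd krec] := IHj (ltnW jn).
  have alj : 0 < al (j%:R * h) by exact: lt_le_trans (al_de _).
  have gaj : `|ga (j%:R * h)| <= `|a|.
    have -> : ga (j%:R * h) = a * (1 - j%:R / n%:R).
      by rewrite /ga /h /w0; field; rewrite n0.
    rewrite normrM ler_piMr// ger0_norm; last first.
      by rewrite subr_ge0 ler_pdivrMr ?ltr0n// mul1r ler_nat ltnW.
    by rewrite gerBl divr_ge0.
  have kM : geom_bounded M k.
    apply: (inverse_kernel_bounded alj M1 _ krec).
    apply: le_trans (_ : de * M <= _); last by rewrite ler_wpM2r// ltW.
    by apply: le_trans M2; rewrite lerD2r ler_wpM2l.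
  have alS : al (j%:R * h) - 2 * ga (j%:R * h) * h - 3 * b * h ^+ 2 = al (j.+1%:R * h).
    by rewrite /al /ga -natr1; ring.
  have gaS : ga (j%:R * h) + 3 * b * h = ga (j.+1%:R * h).
    by rewrite /ga -natr1; ring.
  have := inverse_kernel_shift M1 hM kM krec kpsd; rewrite alS gaS; apply.
  by rewrite lt0r_neq0//; exact: lt_le_trans (al_de _).
have [k kpsd krec] := step n (leqnn n).
have nh : n%:R * h = w0 by rewrite /h mulrC divfK.
have gaw : ga w0 = 0 by rewrite /ga /w0; field.
have alw : al w0 = de by rewrite alE subrr expr0n/= mulr0 subr0.
rewrite nh gaw alw in krec.
have k00 : de * k 0%N 0%N = 1.
  by have := krec 0%N 0%N; rewrite /= !(addr0, mulr0, mul0r, subr0).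
have k11 : de * k 1%N 1%N = b * k 0%N 0%N.
  have := krec 1%N 1%N; rewrite /= !(addr0, add0r, mul0r, subr0) => /eqP.
  by rewrite subr_eq0 => /eqP.
have : 0 <= k 1%N 1%N.
  have := kpsd 2%N (fun i => (i == 1%N)%:R).
  by rewrite !big_ord_recl !big_ord0 /= /bump/= !(mul0r, mul1r, mulr0, addr0, add0r).
rewrite -(pmulr_rge0 _ de0) k11 -(pmulr_rge0 _ de0) mulrCA k00 mulr1 => b1.
by have := lt_le_trans bn b1; rewrite ltxx.
Qed.

End Necessity.

(** * A bounded moment problem *)

Lemma subrXX_le (R : realType) (x y : R) m : 0 <= x <= 1 -> 0 <= y <= 1 ->
  `|x ^+ m - y ^+ m| <= m%:R * `|x - y|.
Proof.
move=> /andP[x0 x1] /andP[y0 y1]; rewrite subrXX normrM mulrC ler_wpM2r//.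
apply: (le_trans (ler_norm_sum _ _ _)).
rewrite -[X in X%:R]card_ord -sumr_const; apply: ler_sum => i _.
by rewrite ger0_norm ?mulr_ge0 ?exprn_ge0// mulr_ile1 ?exprn_ge0// exprn_ile1.
Qed.

Section HausdorffWeights.
Variables (R : realType) (s : nat -> R) (K M : R).
Hypothesis s0 : s 0%N = 1.
Hypothesis sM : forall n, `|s n| <= K * M ^+ n.
Hypothesis M0 : 0 < M.
Hypothesis psd : forall p, 0 <= mom s (p ^+ 2).
Local Notation L := (mom s).

Let K0 : 0 <= K.
Proof. by have := sM 0; rewrite s0 normr1 expr0 mulr1; apply: le_trans. Qed.

Lemma mom_cauchy_schwarz p q : L (p * q) ^+ 2 <= L (p ^+ 2) * L (q ^+ 2).
Proof.
have h x y : 0 <= x ^+ 2 * L (p ^+ 2) + 2 * x * y * L (p * q) + y ^+ 2 * L (q ^+ 2).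
  have := psd (x *: p + y *: q).
  have -> : (x *: p + y *: q) ^+ 2 = x ^+ 2 *: p ^+ 2 + (2 * x * y) *: (p * q) + y ^+ 2 *: q ^+ 2.
    by rewrite [x ^+ 2]expr2 [y ^+ 2]expr2 -!mul_polyC !polyCM polyC_natr; ring.
  by rewrite !linearD !linearZ.
have [q0|q0] := eqVneq (L (q ^+ 2)) 0.
  have [->|pq] := eqVneq (L (p * q)) 0; first by rewrite expr0n/= mulr_ge0.
  (* When L(q^2) = 0 the form is affine in y; this y gives it the value -1. *)
  have := h 1 (- (L (p ^+ 2) + 1) / (2 * L (p * q))).
  rewrite q0 mulr0 addr0 expr1n mul1r mulr1.
  have -> : 2 * (- (L (p ^+ 2) + 1) / (2 * L (p * q))) * L (p * q) = - (L (p ^+ 2) + 1).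
    by field.
  by rewrite opprD addrA subrr add0r lerNr oppr0 ler10.
have qp : 0 < L (q ^+ 2) by rewrite lt_neqAle eq_sym q0 psd.
have := h (L (q ^+ 2)) (- L (p * q)).
have -> : L (q ^+ 2) ^+ 2 * L (p ^+ 2) + 2 * L (q ^+ 2) * - L (p * q) * L (p * q)
  + (- L (p * q)) ^+ 2 * L (q ^+ 2)
  = L (q ^+ 2) * (L (p ^+ 2) * L (q ^+ 2) - L (p * q) ^+ 2) by ring.
by rewrite pmulr_rge0// subr_ge0.
Qed.

Lemma momXnM_bound q : exists C, forall n, `|L ('X^n * q)| <= C * M ^+ n.
Proof.
exists (\sum_(i < size q) `|q`_i| * (K * M ^+ i)) => n.
rewrite -{1}[q]coefK poly_def mulr_sumr linear_sum mulr_suml.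
apply: (le_trans (ler_norm_sum _ _ _)); apply: ler_sum => i _.
rewrite -scalerAr linearZ/= -exprD momXn normrM -mulrA ler_wpM2l//.
by rewrite -mulrA -exprD addnC.
Qed.

(** If |L(X p^2)| = r L(p^2) with r > M, repeated Cauchy-Schwarz gives L(X^(2^j) p^2) >= r^(2^j)
    L(p^2) for j >= 1, against the growth rate M. *)
Lemma momX_bound p : `|L ('X * p ^+ 2)| <= M * L (p ^+ 2).
Proof.
rewrite leNgt; apply/negP => h; set A0 := L (p ^+ 2) in h.
have A00 : 0 <= A0 by exact: psd.
have CS n : L ('X^n * p ^+ 2) ^+ 2 <= L ('X^(2 * n) * p ^+ 2) * A0.
  have := mom_cauchy_schwarz ('X^n * p) p.
  by rewrite exprMn -exprM mulnC -mulrA -expr2.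
have A0p : 0 < A0.
  rewrite lt_neqAle A00 andbT eq_sym; apply/eqP => A0E.
  have := CS 1%N; rewrite A0E mulr0 expr1 => /le_gtF/negbT; rewrite -leNgt.
  have : 0 < L ('X * p ^+ 2) ^+ 2.
    by rewrite -real_normK ?num_real// exprn_gt0// (le_lt_trans _ h)// A0E mulr0.
  by move=> /lt_geF ->.
have [r rE] : exists r, `|L ('X * p ^+ 2)| = A0 * r.
  by exists (`|L ('X * p ^+ 2)| / A0); rewrite [A0 * _]mulrC divfK// lt0r_neq0.
have rM : M < r by move: h; rewrite rE mulrC ltr_pM2l.
have r0 : 0 < r by exact: lt_trans rM.
have big j : A0 * r ^+ (2 ^ j.+1) <= L ('X^(2 ^ j.+1) * p ^+ 2).
  elim: j => [|j IHj].
    have := CS 1%N; rewrite expr1 muln1 expn1 -real_normK ?num_real//.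
    rewrite rE.
    by rewrite exprMn [A0 ^+ 2]expr2 -mulrA [X in _ <= X]mulrC ler_pM2l.
  have CSj := CS (2 ^ j.+1)%N; rewrite -expnS in CSj.
  rewrite -(ler_pM2r A0p); apply: le_trans CSj.
  have -> : A0 * r ^+ (2 ^ j.+2) * A0 = (A0 * r ^+ (2 ^ j.+1)) ^+ 2.
    by rewrite exprMn -exprM mulnC -expnS; ring.
  by rewrite lerXn2r// nnegrE; [rewrite mulr_ge0// exprn_ge0// ltW|
    apply: le_trans IHj; rewrite mulr_ge0// exprn_ge0// ltW].
have [C hC] := momXnM_bound (p ^+ 2).
have lim0 : (fun n => (M / r) ^+ n) @ \oo --> (0 : R).
  by apply: cvg_expr; rewrite gtr0_norm ?divr_gt0// ltr_pdivrMr// mul1r.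
have C0 : 0 <= C by have := hC 0%N; rewrite expr0 mulr1; apply: le_trans.
have e0 : 0 < A0 / (C + 1) by rewrite divr_gt0// ltr_wpDl.
move/cvgrPdist_lt : lim0 => /(_ _ e0) [n _ /(_ (2 ^ n.+1)%N)].
rewrite /= sub0r normrN ger0_norm; last by rewrite exprn_ge0// divr_ge0// ltW.
have nn : (n <= 2 ^ n.+1)%N by rewrite ltnW// (ltn_trans (ltnSn n))// ltn_expl.
move=> /(_ nn); rewrite ltr_pdivlMr; last by rewrite ltr_wpDl.
apply/negP; rewrite -leNgt expr_div_n.
rewrite -(ler_pM2r (exprn_gt0 (2 ^ n.+1) r0)) (le_trans (big n))//.
apply: (le_trans (ler_norm _)); apply: (le_trans (hC _)).
rewrite mulrAC divfK; last by rewrite expf_neq0// lt0r_neq0.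
by rewrite mulrC ler_wpM2l ?exprn_ge0 ?(ltW M0)// lerDl.
Qed.

(** The affine map of [-M, M] onto [0, 1]. *)
Definition unitX : {poly R} := (2 * M)^-1 *: ('X + M%:P).

Let unitX_ge0 p : 0 <= L (unitX * p ^+ 2).
Proof.
rewrite /unitX -scalerAl linearZ/= mulr_ge0 ?invr_ge0 ?mulr_ge0 ?(ltW M0)//.
rewrite mulrDl linearD mul_polyC linearZ/= -lerBlDr sub0r.
by have := momX_bound p; rewrite ler_norml => /andP[].
Qed.

Let unitXC : 1 - unitX = (2 * M)^-1 *: (M%:P - 'X).
Proof.
apply/eqP; rewrite subr_eq /unitX -scalerDr.
have -> : M%:P - 'X + ('X + M%:P) = (2 * M)%:P by rewrite polyCM polyC_natr; ring.
by rewrite -mul_polyC -polyCM mulVf// mulf_neq0 ?lt0r_neq0.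
Qed.

Let unitXC_ge0 p : 0 <= L ((1 - unitX) * p ^+ 2).
Proof.
rewrite unitXC -scalerAl linearZ/= mulr_ge0 ?invr_ge0 ?mulr_ge0 ?(ltW M0)//.
rewrite mulrBl linearB mul_polyC linearZ/= subr_ge0.
by have := momX_bound p; rewrite ler_norml => /andP[].
Qed.

(** Even powers go into a square; two odd exponents are handled by u (1 - u) = u (1 - u)^2 + (1 - u)
    u^2. *)
Lemma mom_bernstein_ge0 i j : 0 <= L (unitX ^+ i * (1 - unitX) ^+ j).
Proof.
rewrite -(odd_double_half i) -(odd_double_half j) -!muln2 !exprD !exprM.
set u := unitX ^+ i./2 * (1 - unitX) ^+ j./2.
have e x y : x * (unitX ^+ i./2) ^+ 2 * (y * ((1 - unitX) ^+ j./2) ^+ 2) = x * y * u ^+ 2.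
  by rewrite /u exprMn; ring.
rewrite e; case: (odd i); case: (odd j); rewrite /= ?expr1 ?expr0 ?mulr1 ?mul1r.
- have -> : unitX * (1 - unitX) * u ^+ 2 = unitX * ((1 - unitX) * u) ^+ 2
    + (1 - unitX) * (unitX * u) ^+ 2 by ring.
  by rewrite linearD; apply: addr_ge0; [exact: unitX_ge0|exact: unitXC_ge0].
- exact: unitX_ge0.
- exact: unitXC_ge0.
- exact: psd.
Qed.

(** L of the Bernstein basis polynomials: the mass at k/n of the n-th approximating measure. *)
Definition bernstein_weight n k : R :=
  'C(n, k)%:R * L (unitX ^+ k * (1 - unitX) ^+ (n - k)).

Lemma bernstein_weight_ge0 n k : 0 <= bernstein_weight n k.
Proof. by rewrite mulr_ge0// mom_bernstein_ge0. Qed.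

(* k (k-1) ... (k-j+1) / (n (n-1) ... (n-j+1)): the Bernstein operator maps this
   function of k to the monomial x^j exactly. *)
Fixpoint ffact_ratio j n k : R :=
  if j is j'.+1 then k%:R / n%:R * ffact_ratio j' n.-1 k.-1 else 1.

Lemma bernstein_ffact_ratio j n : (j <= n)%N ->
  \sum_(k < n.+1) bernstein_weight n k * ffact_ratio j n k = L (unitX ^+ j).
Proof.
move=> jn; pose S j n := \sum_(k < n.+1) ('C(n, k)%:R * ffact_ratio j n k) *:
  (unitX ^+ k * (1 - unitX) ^+ (n - k)).
transitivity (L (S j n)).
  rewrite linear_sum; apply: eq_bigr => k _; rewrite linearZ/= /bernstein_weight.
  by rewrite mulrAC.
congr (L _); elim: j n jn => [|j IHj] n jn.
  rewrite expr0 -[RHS](expr1n _ n) -[X in X ^+ n](subrK unitX) exprDn.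
  by apply: eq_bigr => k _; rewrite /= mulr1 [unitX ^+ k * _]mulrC scaler_nat.
case: n jn => // n jn; rewrite /S big_ord_recl/= mul0r mul0r mulr0 scale0r add0r.
rewrite exprS -(IHj n)// /S mulr_sumr; apply: eq_bigr => k _.
rewrite /bump/= add1n subSS add0n -[RHS]scalerAr [X in _ = _ *: X]mulrA -exprS; congr (_ *: _).
rewrite !mulrA; congr (_ * _); rewrite -natrM mulnC -mul_bin_diag natrM.
by rewrite mulrAC divff ?mul1r// pnatr_eq0.
Qed.

(** Removing one factor moves the ratio from k/n to (k-1)/(n-1), at distance at most 1/(n-1); the
    errors add up by j^2 + j <= (j + 1)^2. *)
Lemma ffact_ratio_bound j n k : (k <= n)%N -> (j < n)%N ->
  `|ffact_ratio j n k - (k%:R / n%:R) ^+ j| <= j%:R ^+ 2 / (n - j)%:R.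
Proof.
elim: j n k => [|j IHj] n k kn jn; first by rewrite /= expr0 subrr normr0 mulr_ge0// invr_ge0.
have n0 : (0 < n)%N by exact: leq_ltn_trans jn.
have kn01 : 0 <= (k%:R / n%:R : R) <= 1.
  by apply/andP; split; [exact: divr_ge0|rewrite ler_pdivrMr ?ltr0n// mul1r ler_nat].
rewrite /= exprS -mulrBr normrM.
have [->|k0] := eqVneq k 0%N.
  by rewrite mul0r normr0 mul0r mulr_ge0 ?sqr_ge0// invr_ge0.
case/andP : (kn01) => kn0 kn1.
rewrite (ger0_norm kn0); apply: le_trans (ler_wpM2r (normr_ge0 _) kn1) _; rewrite mul1r.
have n1 : (0 < n.-1)%N by case: n n0 jn {kn kn01 kn0 kn1} => // -[|n].
have k1n1 : (k.-1 <= n.-1)%N by rewrite -!subn1 leq_sub2r.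
have kn01' : 0 <= (k.-1%:R / n.-1%:R : R) <= 1.
  by apply/andP; split; [exact: divr_ge0|rewrite ler_pdivrMr ?ltr0n// mul1r ler_nat].
have jn1 : (j < n.-1)%N by case: n n0 jn {kn kn01 kn0 kn1 n1 k1n1 kn01'}.
rewrite -(subrKA ((k.-1%:R / n.-1%:R) ^+ j)).
apply: (le_trans (ler_normD _ _)).
apply: (@le_trans _ _ (j%:R ^+ 2 / (n.-1 - j)%:R + j%:R / (n.-1 - j)%:R)).
  apply: lerD; first exact: IHj.
  apply: (le_trans (subrXX_le _ kn01' kn01)); rewrite ler_wpM2l//.
  have D0 : 0 < (n.-1 - j)%:R :> R by rewrite ltr0n subn_gt0.
  have np : 0 < n%:R :> R by rewrite ltr0n.
  have n1p : 0 < n.-1%:R :> R by rewrite ltr0n.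
  apply: (@le_trans _ _ (n.-1%:R^-1)); last first.
    by rewrite lef_pV2 ?posrE// ler_nat leq_subr.
  have -> : k.-1%:R / n.-1%:R - k%:R / n%:R = - ((n%:R - k%:R) / n%:R) / n.-1%:R :> R.
    have -> : n%:R = n.-1%:R + 1 :> R by rewrite natr1 prednK.
    have -> : k%:R = k.-1%:R + 1 :> R by rewrite natr1 prednK// lt0n.
    by field; rewrite natr1 !pnatr_eq0 -!lt0n n1.
  rewrite normrM normrN normrV ?unitfE ?lt0r_neq0// [`|n.-1%:R|]gtr0_norm//.
  rewrite ler_piMl ?invr_ge0 ?(ltW n1p)// ger0_norm; last first.
    by rewrite divr_ge0 ?(ltW np)// subr_ge0 ler_nat.
  by rewrite ler_pdivrMr// mul1r gerBl.
have -> : (n - j.+1 = n.-1 - j)%N by rewrite subnS -!subn1 subnAC.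
rewrite -mulrDl ler_wpM2r ?invr_ge0// -[j.+1%:R]natr1 sqrrD1 mulr2n.
by have := ler0n R j; lra.
Qed.

End HausdorffWeights.

Lemma ultra_bounded_cvg (R : realType) (U : set_system nat) (f : nat -> R) (A B : R) :
  UltraFilter U -> (forall n, A <= f n <= B) -> exists l : R, f @ U --> l.
Proof.
move=> UU fAB.
have FAB : (f @ U) `[A, B]%classic.
  by apply: (@filterS _ U _ setT) => [n _|]; [rewrite /= in_itv/= fAB|exact: filterT].
have [p [_ clp]] := @segment_compact R A B (f @ U) _ FAB.
exists p => N Np; have [//|UN] := in_ultra_setVsetC (f @^-1` N) UU.
have [y [Ny yN]] := clp (~` N) N UN Np.
by [].
Qed.

Section StepFunctions.
Variable R : realType.

Definition incr (G : nat -> R) i := G i - (if i is i'.+1 then G i' else 0).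

Lemma sum_incr_threshold (be : nat -> bool) N :
  (forall i, be i -> be i.+1) -> be N ->
  exists m, [/\ (m <= N)%N, be m, (forall i, (i < m)%N -> ~~ be i) &
    forall a : nat -> R, \sum_(i < N.+1) a i * incr (fun i => (be i)%:R) i = a m].
Proof.
move=> mono beN; have exbe : exists i, be i by exists N.
have [m bem minm] := ex_minnP exbe; exists m; split => //; first exact: minm.
  by move=> i im; apply/negP => /minm; rewrite leqNgt im.
move=> a; have mN : (m < N.+1)%N by rewrite ltnS minm.
have up i : (m <= i)%N -> be i.
  by move=> /subnK <-; elim: (i - m)%N => // k; rewrite addSn; exact: mono.
have dn i : (i < m)%N -> be i = false.
  by move=> im; apply/negP => /minm; rewrite leqNgt im.
rewrite (bigD1 (Ordinal mN))//= big1 ?addr0 => [|i im].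
  rewrite /incr bem; case: m {minm bem mN up} dn => [|m] dn; first by rewrite subr0 mulr1.
  by rewrite dn// subr0 mulr1.
rewrite /incr; have [lt_im|] := ltnP i m.
  rewrite dn//; case: (i : nat) lt_im => [|j] lt_jm; first by rewrite subrr mulr0.
  by rewrite dn ?subrr ?mulr0// ltnW.
rewrite leq_eqVlt => /predU1P[mi|lt_mi]; first by rewrite -val_eqE/= mi eqxx in im.
rewrite up 1?ltnW//; case: (i : nat) lt_mi => // j lt_mj.
by rewrite up// subrr mulr0.
Qed.

(** The increments single out the first grid point at which [be] holds, and y lies at most 1/N below
    it. Both values of the quantile function and atoms k/n take the place of y. *)
Lemma step_approx (be : nat -> bool) N (y : R) j : (0 < N)%N ->
  (forall i, be i -> be i.+1) -> be N -> 0 <= y <= 1 ->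
  (forall i, (i <= N)%N -> be i -> y <= i%:R / N%:R) ->
  (forall i, (i <= N)%N -> ~~ be i -> i%:R / N%:R <= y) ->
  `|y ^+ j - \sum_(i < N.+1) (i%:R / N%:R) ^+ j * incr (fun i => (be i)%:R) i|
    <= j%:R / N%:R.
Proof.
move=> N0 mono beN y01 h1 h2.
have [m [mN bem minm sumE]] := sum_incr_threshold mono beN.
rewrite (sumE (fun i => (i%:R / N%:R) ^+ j)).
have Np : 0 < N%:R :> R by rewrite ltr0n.
have m01 : 0 <= (m%:R / N%:R : R) <= 1.
  by apply/andP; split; [exact: divr_ge0|rewrite ler_pdivrMr// mul1r ler_nat].
apply: (le_trans (subrXX_le _ y01 m01)); rewrite ler_wpM2l//.
have ym := h1 m mN bem; rewrite ler0_norm ?subr_le0// opprB lerBlDr -lerBlDl.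
apply: le_trans (_ : (m.-1)%:R / N%:R <= _).
  rewrite -[X in _ - X]mul1r -mulrBl ler_wpM2r ?invr_ge0 ?(ltW Np)// lerBlDr natr1 ler_nat.
  exact: leqSpred.
case: m {ym m01 bem sumE} mN minm => [_ _|m mN minm] /=; first by rewrite mul0r; case/andP : y01.
by apply: h2; [exact: ltnW|exact: minm].
Qed.

End StepFunctions.

Lemma bounded_fun_integrable d (T : measurableType d) (R : realType)
    (P : {measure set T -> \bar R}) (f : T -> R) (k : R) : (P setT < +oo)%E ->
  measurable_fun setT f -> (forall x, `|f x| <= k) -> P.-integrable setT (EFin \o f).
Proof.
move=> Poo mf fk; apply: measurable_bounded_integrable => //.
exists k; split; first exact: num_real.
by move=> y ky x _; apply: le_trans (fk x) (ltW ky).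
Qed.

Section WeakLimit.
Variables (R : realType) (b : nat -> nat -> R) (s : nat -> R).
Hypothesis b0 : forall n k, 0 <= b n k.
Hypothesis b1 : forall n, \sum_(k < n.+1) b n k = 1.
Hypothesis bs : forall j,
  (fun n => \sum_(k < n.+1) b n k * (k%:R / n%:R) ^+ j) @ \oo --> s j.

Definition unit_lebesgue : {measure set (measurableTypeR R) -> \bar R} :=
  mrestr lebesgue_measure (measurable_itv `]0, 1]%R).

Let grid01 n (k : 'I_n.+1) : 0 <= (k%:R / n%:R : R) <= 1.
Proof.
apply/andP; split; first exact: divr_ge0.
case: n k => [|n] k; first by rewrite invr0 mulr0.
by rewrite ler_pdivrMr ?ltr0n// mul1r ler_nat -ltnS.
Qed.

(* The measures sum_k b n k delta_(k/n) have a limit along an ultrafilter, with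
   distribution function F; Q is the quantile function of that limit. *)
Lemma weak_limit : exists Q : R -> R, [/\ nondecreasing_fun Q,
  (forall u, 0 <= Q u <= 1) &
  forall j, \int[unit_lebesgue]_u (Q u ^+ j) = s j].
Proof.
have [U [UU Uoo]] := ultraFilterLemma eventually_filter.
have PU : ProperFilter U by exact: ultra_proper.
pose Fn (x : R) n : R := \sum_(k < n.+1) b n k * (k%:R / n%:R <= x)%R%:R.
have Fn01 x n : 0 <= Fn x n <= 1.
  apply/andP; split; first by apply: sumr_ge0 => k _; rewrite mulr_ge0.
  by rewrite -[leRHS](b1 n); apply: ler_sum => k _; rewrite ler_piMr// lern1 leq_b1.
pose F (x : R) : R := lim (Fn x @ U).
have cvF x : Fn x @ U --> F x.
  by have [l /cvgP] := ultra_bounded_cvg UU (Fn01 x).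
have Fmono x y : x <= y -> F x <= F y.
  move=> xy; apply: (ler_cvg_to (cvF x) (cvF y)); near=> n.
  apply: ler_sum => k _; rewrite ler_wpM2l// ler_nat.
  by have [kx|//] := leP (k%:R / n%:R) x; rewrite (le_trans kx).
have F01 x : 0 <= F x <= 1.
  apply/andP; split.
    by apply: (cvgr_to_ge (cvF x)); near=> n; have /andP[] := Fn01 x n.
  by apply: (cvgr_to_le (cvF x)); near=> n; have /andP[] := Fn01 x n.
have F1 : F 1 = 1.
  have : Fn 1 @ U --> (1 : R).
    have -> : Fn 1 = fun=> 1.
      apply/funext => n; rewrite /Fn -[RHS](b1 n); apply: eq_bigr => k _.
      by case/andP : (grid01 k) => _ ->; rewrite mulr1.
    exact: cvg_cst.
  by move/cvg_lim; apply.
(* The point 0 keeps the set nonempty; capping u at 1 = F 1 makes the threshold be reached at x = 1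
   for every real u. *)
pose S (u : R) := [set x : R | x = 0 \/ (0 <= x <= 1 /\ F x < Num.min u 1)].
pose Q (u : R) : R := sup (S u).
have S1 u : ubound (S u) 1 by move=> x [->|[/andP[]]].
have hS u : has_ubound (S u) by exists 1.
have S0 u : S u 0 by left.
have Q01 u : 0 <= Q u <= 1.
  apply/andP; split; first exact: ub_le_sup.
  by apply: ge_sup => //; exists 0.
have Qmono : nondecreasing_fun Q.
  move=> u v uv; apply: ge_sup; first by exists 0.
  move=> x [->|[x01 Fx]]; first exact: ub_le_sup.
  apply: ub_le_sup => //; right; split => //; apply: lt_le_trans Fx _.
  by rewrite le_min !ge_min uv lexx !orbT.
(* F need not be right continuous, so Q u <= x and u <= F x need not be equivalent; [Qhi] and [Qlo]
   are two one-sided substitutes. *)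
have Qhi u x : 0 <= x -> Num.min u 1 <= F x -> Q u <= x.
  move=> x0 uF; apply: ge_sup; first by exists 0.
  move=> y [->//|[_ Fy]]; rewrite leNgt; apply/negP => /ltW /Fmono.
  by apply/negP; rewrite -ltNge (lt_le_trans Fy).
have Qlo u x : 0 <= x <= 1 -> ~~ (Num.min u 1 <= F x) -> x <= Q u.
  by move=> x01; rewrite -ltNge => uF; apply: ub_le_sup => //; right.
have mQ : measurable_fun setT Q by exact: nondecreasing_measurable.
exists Q; split => // j.
have U1 : unit_lebesgue setT = 1%E.
  by rewrite /unit_lebesgue /= /mrestr setTI lebesgue_measure_itv/= lte_fin ltr01 oppr0 adde0.
have Poo : (unit_lebesgue setT < +oo)%E by rewrite U1 ltry.
have P1 : fine (unit_lebesgue setT) = 1 by rewrite U1.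
have mb x : measurable_fun setT (fun u : R => (Num.min u 1 <= x)%R%:R : R).
  apply: nonincreasing_measurable => // u v uv; rewrite ler_nat.
  have [vx|//] := leP (Num.min v 1) x; rewrite (le_trans _ vx)//.
  by rewrite le_min !ge_min uv lexx !orbT.
have ib x : unit_lebesgue.-integrable setT (EFin \o (fun u : R => (Num.min u 1 <= x)%R%:R : R)).
  apply: (@bounded_fun_integrable _ _ _ _ _ 1 Poo (mb x)) => u.
  by rewrite ger0_norm// lern1 leq_b1.
have Ib x : \int[unit_lebesgue]_u ((Num.min u 1 <= F x)%R%:R : R) = F x.
  have /andP[Fx0 Fx1] := F01 x.
  have -> : (fun u : R => (Num.min u 1 <= F x)%R%:R : R) =
    \1_[set u | Num.min u 1 <= F x].
    by apply/funext => u; rewrite indicE; congr (nat_of_bool _)%:R; apply/idP/idP; rewrite inE.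
  have mA : measurable [set u : R | Num.min u 1 <= F x].
    apply: is_interval_measurable => u v /= ux vx t /andP[ut tv].
    by rewrite (le_trans _ vx)// le_min !ge_min tv lexx !orbT.
  rewrite /Rintegral integral_indic//= setIT.
  rewrite /unit_lebesgue /= /mrestr.
  have -> : [set u : R | Num.min u 1 <= F x] `&` `]0, 1]%classic = `]0, F x]%classic.
    apply/seteqP; split => u /=; rewrite !in_itv/=.
      by move=> [+ /andP[u0 u1]]; rewrite u0 (min_idPl u1).
    move=> /andP[u0 uF]; have u1 := le_trans uF Fx1.
    by rewrite u0 u1 (min_idPl u1).
  rewrite lebesgue_measure_itv/= lte_fin; case: ltP => [_|Fx]; first by rewrite oppr0 adde0.
  by apply/le_anti; rewrite Fx Fx0.
have Qj u : `|Q u ^+ j| <= 1.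
  by have /andP[Q0 Q1] := Q01 u; rewrite ger0_norm ?exprn_ge0// exprn_ile1.
have iQ : unit_lebesgue.-integrable setT (EFin \o (fun u => Q u ^+ j)).
  by apply: (@bounded_fun_integrable _ _ _ _ _ 1) => //; exact: measurable_funX.
have near N : (0 < N)%N ->
    `|\int[unit_lebesgue]_u (Q u ^+ j) - s j| <= j%:R / N%:R + j%:R / N%:R.
  move=> N0; have Np : 0 < N%:R :> R by rewrite ltr0n.
  have NN : N%:R / N%:R = 1 :> R by rewrite divff ?lt0r_neq0.
  pose x i : R := i%:R / N%:R.
  have x0 i : 0 <= x i by exact: divr_ge0.
  have xS i : x i <= x i.+1 by rewrite ler_wpM2r ?invr_ge0 ?(ltW Np)// ler_nat.
  have x01 i : (i <= N)%N -> 0 <= x i <= 1.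
    by move=> iN; rewrite x0 -NN ler_wpM2r ?invr_ge0 ?(ltW Np)// ler_nat.
  (* The Stieltjes sum of x^j against F on the grid i/N; the integral of Q^j and s j are each within
     j/N of it. *)
  pose V := \sum_(i < N.+1) x i ^+ j * incr (fun i => F (x i)) i.
  rewrite -(subrKA V); apply: (le_trans (ler_normD _ _)); apply: lerD.
    pose g u := \sum_(i < N.+1) x i ^+ j * incr (fun i => (Num.min u 1 <= F (x i))%R%:R) i.
    have iinc i : unit_lebesgue.-integrable setT
        (EFin \o (fun u => incr (fun i => (Num.min u 1 <= F (x i))%R%:R : R) i)).
      rewrite /incr; case: i => [|i]; first by under eq_fun do rewrite subr0; exact: ib.
      exact: (integrableB measurableT (ib _) (ib _)).
    have iz i : unit_lebesgue.-integrable setT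
        (EFin \o (fun u => x i ^+ j * incr (fun i => (Num.min u 1 <= F (x i))%R%:R : R) i)).
      exact: (integrableZl measurableT _ (iinc i)).
    have ig n : unit_lebesgue.-integrable setT
        (EFin \o (fun u => \sum_(i < n) x i ^+ j * incr (fun i => (Num.min u 1 <= F (x i))%R%:R : R) i)).
      have -> : (EFin \o (fun u => \sum_(i < n) x i ^+ j * incr (fun i => (Num.min u 1 <= F (x i))%R%:R : R) i)) =
          (fun u => (\sum_(i < n) (x i ^+ j * incr (fun i => (Num.min u 1 <= F (x i))%R%:R : R) i)%:E)%E).
        by apply/funext => u; rewrite /= sumEFin.
      by apply: integrable_sum => // i _; exact: iz.
    have Ig : \int[unit_lebesgue]_u g u = V.
      rewrite /g /V; elim: N.+1 => [|n IHn].
        under eq_Rintegral do rewrite big_ord0.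
        by rewrite big_ord0 Rintegral_cst// mul0r.
      have -> : (fun u : R => \sum_(i < n.+1) x i ^+ j * incr (fun i => (Num.min u 1 <= F (x i))%R%:R : R) i) =
          (fun u => \sum_(i < n) x i ^+ j * incr (fun i => (Num.min u 1 <= F (x i))%R%:R : R) i
           + x n ^+ j * incr (fun i => (Num.min u 1 <= F (x i))%R%:R : R) n).
        by apply/funext => u; rewrite big_ord_recr.
      rewrite RintegralD// big_ord_recr/= IHn; congr (_ + _).
      rewrite RintegralZl//; congr (_ * _); rewrite /incr; case: n {IHn} => [|n].
        by under eq_Rintegral do rewrite subr0; rewrite subr0 Ib.
      by rewrite RintegralB// !Ib.
    rewrite -Ig -RintegralB//; last exact: ig.
    have bnd u : `|Q u ^+ j - g u| <= j%:R / N%:R.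
      apply: (@step_approx _ (fun i => Num.min u 1 <= F (x i))%R) => //.
      - by move=> i /le_trans; apply; exact: Fmono.
      - by rewrite /x NN F1 ge_min lexx orbT.
      - by move=> i _; exact: Qhi.
      - by move=> i iN; apply: Qlo; exact: x01.
    have igB : unit_lebesgue.-integrable setT (EFin \o (fun u => Q u ^+ j - g u)).
      exact: (integrableB measurableT iQ (ig _)).
    apply: (le_trans (le_normr_Rintegral measurableT igB)).
    apply: (@le_trans _ _ (\int[unit_lebesgue]_u (j%:R / N%:R))).
      apply: le_Rintegral => //; first exact: (integrable_norm igB).
      apply: (@bounded_fun_integrable _ _ _ _ _ (j%:R / N%:R)) => // u.
      by rewrite ger0_norm// divr_ge0.
    by rewrite Rintegral_cst// P1 mulr1.
  rewrite distrC.
  have cvs : (fun n => \sum_(k < n.+1) b n k * (k%:R / n%:R) ^+ j) @ U --> s j.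
    by move=> A /bs; exact: Uoo.
  have cvV : (fun n => \sum_(i < N.+1) x i ^+ j * incr (fun i => Fn (x i) n) i) @ U --> V.
    apply: cvg_sumr => i _; apply: cvgM; first exact: cvg_cst.
    rewrite /incr; case: (i : nat) => [|i']; last by apply: cvgB; exact: cvF.
    by under eq_fun do rewrite subr0; rewrite subr0; exact: cvF.
  apply: (cvgr_to_le (cvg_norm (cvgB cvs cvV))); near=> n; rewrite !fctE.
  have -> : \sum_(i < N.+1) x i ^+ j * incr (fun i => Fn (x i) n) i =
    \sum_(k < n.+1) b n k * \sum_(i < N.+1) x i ^+ j *
       incr (fun i => (k%:R / n%:R <= x i)%R%:R) i.
    under [RHS]eq_bigr do rewrite mulr_sumr; rewrite exchange_big; apply: eq_bigr => i _.
    under [RHS]eq_bigr do rewrite mulrCA; rewrite -mulr_sumr; congr (_ * _).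
    rewrite /incr /Fn; case: (i : nat) => [|i'].
      by rewrite subr0; apply: eq_bigr => k _; rewrite subr0.
    by rewrite -sumrB; apply: eq_bigr => k _; rewrite mulrBr.
  rewrite -sumrB; apply: (le_trans (ler_norm_sum _ _ _)).
  rewrite -[leRHS]mul1r -[X in _ <= X * _](b1 n) mulr_suml; apply: ler_sum => k _.
  rewrite -mulrBr normrM (ger0_norm (b0 _ _)) ler_wpM2l//.
  apply: (@step_approx _ (fun i => k%:R / n%:R <= x i)%R) => //.
  - by move=> i /le_trans; apply.
  - by rewrite /x NN; case/andP : (grid01 k).
  - by move=> i _; rewrite -ltNge => /ltW.
apply/eqP; rewrite -subr_eq0 -normr_eq0 eq_le normr_ge0 andbT.
apply/ler_addgt0Pr => e e0; rewrite add0r.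
pose N := (Num.truncn (2 * j%:R / e)).+1.
apply: (le_trans (near N isT)); rewrite -mulrDl ler_pdivrMr ?ltr0n//.
by have := truncnS_gt (2 * j%:R / e); rewrite -/N ltr_pdivrMr//; lra.
Unshelve. all: by end_near. Qed.

End WeakLimit.

Section MomentProblem.
Variable R : realType.
Implicit Types (s : nat -> R) (p : {poly R}).

Lemma integrable_poly (P : {measure set (measurableTypeR R) -> \bar R}) (f : R -> R) p :
  (forall n, P.-integrable setT (EFin \o (fun x => f x ^+ n))) ->
  P.-integrable setT (EFin \o (fun x => p.[f x])) /\
  \int[P]_x p.[f x] = mom (fun n => \int[P]_x (f x ^+ n)) p.
Proof.
move=> fi.
have fz n k : P.-integrable setT (EFin \o (fun x => k * f x ^+ n)).
  exact: (integrableZl measurableT _ (fi n)).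
suff h N (a : nat -> R) : P.-integrable setT (EFin \o (fun x => \sum_(i < N) a i * f x ^+ i))
    /\ \int[P]_x (\sum_(i < N) a i * f x ^+ i) = \sum_(i < N) a i * \int[P]_x (f x ^+ i).
  have -> : (fun x => p.[f x]) = (fun x => \sum_(i < size p) p`_i * f x ^+ i).
    by apply/funext => x; rewrite horner_coef.
  exact: h.
elim: N => [|N [IH1 IH2]].
  have -> : (fun x => \sum_(i < 0) a i * f x ^+ i) = (fun=> 0).
    by apply/funext => x; rewrite big_ord0.
  by rewrite big_ord0 Rintegral_cst// mul0r; split => //; exact: integrable0.
have -> : (fun x => \sum_(i < N.+1) a i * f x ^+ i) =
    (fun x => \sum_(i < N) a i * f x ^+ i + a N * f x ^+ N).
  by apply/funext => x; rewrite big_ord_recr.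
split; first exact: (integrableD measurableT IH1 (fz _ _)).
by rewrite RintegralD// IH2 RintegralZl// big_ord_recr.
Qed.

Lemma has_moments_poly (P : {measure set (measurableTypeR R) -> \bar R}) s p :
  has_moments P s -> P.-integrable setT (EFin \o (fun x => p.[x])) /\
  \int[P]_x p.[x] = mom s p.
Proof.
move=> h; have [h1 ->] := @integrable_poly P id p (fun n => (h n).1); split => //.
by apply: eq_bigr => i _; congr (_ * _); rewrite /Rintegral (h i).2.
Qed.

Lemma hamburger_bounded s (K M : R) : s 0%N = 1 -> 0 < M ->
  (forall n, `|s n| <= K * M ^+ n) -> (forall p, 0 <= mom s (p ^+ 2)) ->
  positive_definite s.
Proof.
move=> s0 M0 sM psd.
have b0 n k : 0 <= bernstein_weight s M n k by exact: bernstein_weight_ge0 sM M0 psd n k.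
have b1 n : \sum_(k < n.+1) bernstein_weight s M n k = 1.
  have := @bernstein_ffact_ratio R s M 0 n (leq0n n).
  under eq_bigr do rewrite mulr1.
  by move=> ->; rewrite expr0 -(expr0 'X) momXn.
have bs j : (fun n => \sum_(k < n.+1) bernstein_weight s M n k * (k%:R / n%:R) ^+ j) @ \oo -->
    mom s (unitX M ^+ j).
  apply/cvgrPdist_le => e e0; near=> n.
  have jn : (j < n)%N by near: n; exact: nbhs_infty_gt.
  rewrite -(bernstein_ffact_ratio s M (ltnW jn)) -sumrB.
  apply: (le_trans (ler_norm_sum _ _ _)).
  apply: (@le_trans _ _ (\sum_(k < n.+1) bernstein_weight s M n k * (j%:R ^+ 2 / (n - j)%:R))).
    apply: ler_sum => k _; rewrite -mulrBr normrM (ger0_norm (b0 _ _)) ler_wpM2l//.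
    by apply: ffact_ratio_bound => //; rewrite -ltnS.
  rewrite -mulr_suml b1 mul1r ler_pdivrMr ?ltr0n ?subn_gt0// mulrC -ler_pdivrMr//.
  apply: ltW; apply: lt_le_trans (truncnS_gt _) _; rewrite ler_nat ltn_subRL.
  by near: n; exact: nbhs_infty_gt.
have [Q [Qm Q01 IQ]] := weak_limit b0 b1 bs.
have mQ : measurable_fun setT Q by exact: nondecreasing_measurable.
pose phi u : R := 2 * M * Q u - M.
have mphi : measurable_fun [set: measurableTypeR R] (phi : measurableTypeR R -> measurableTypeR R).
  by apply: measurable_funB => //; exact: measurable_funM.
pose mu := measure_function_pushforward__canonical__measure_function_Measure
  (unit_lebesgue R) mphi.
have Poo : (unit_lebesgue R setT < +oo)%E.
  by rewrite /unit_lebesgue /= /mrestr setTI lebesgue_measure_itv/= lte_fin ltr01 oppr0 adde0 ltry.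
have iQ n : (unit_lebesgue R).-integrable setT (EFin \o (fun u => Q u ^+ n)).
  apply: (@bounded_fun_integrable _ _ _ _ _ 1 Poo); first exact: measurable_funX.
  by move=> u; have /andP[q0 q1] := Q01 u; rewrite ger0_norm ?exprn_ge0// exprn_ile1.
have key n : (unit_lebesgue R).-integrable setT (EFin \o (fun u => phi u ^+ n)) /\
    \int[unit_lebesgue R]_u (phi u ^+ n) = s n.
  (* [phi] undoes the normalisation: q composed with [unitX M] is X^n. *)
  pose q : {poly R} := ((2 * M) *: 'X - M%:P) ^+ n.
  have -> : (fun u => phi u ^+ n) = (fun u => q.[Q u]).
    by apply/funext => u; rewrite /q horner_exp !hornerE.
  have [q1 ->] := integrable_poly q iQ; split=> //.
  transitivity (mom s (q \Po unitX M)).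
    rewrite comp_polyE linear_sum; apply: eq_bigr => i _; rewrite linearZ/=.
    by rewrite IQ.
  rewrite /q rmorphXn/= comp_polyB comp_polyZ comp_polyX comp_polyC /unitX.
  rewrite scalerA divff ?scale1r ?addrK ?momXn//.
  by rewrite mulf_neq0// lt0r_neq0.
exists mu => n; have [k1 k2] := key n.
have mX : measurable_fun [set: measurableTypeR R] (fun x : measurableTypeR R => (x ^+ n)%:E).
  by apply/measurable_EFinP; exact: measurable_funX.
split; first exact: integrable_pushforward.
rewrite integral_pushforward//= preimage_setT -k2 /Rintegral fineK//.
exact: integrable_fin_num.
Unshelve. all: by end_near. Qed.

End MomentProblem.

(** * Support *)

Section Localization.
Variables (R : realType) (mu : probability (measurableTypeR R) R).
Variables (s : nat -> R) (K M : R).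
Hypothesis mus : has_moments mu s.
Hypothesis M1 : 1 <= M.
Hypothesis sM : forall n, `|s n| <= K * M ^+ n.
Implicit Types (p : {poly R}) (A D : set (measurableTypeR R)).

Lemma bernoulli_le (y : R) n : -1 <= y -> 1 + n%:R * y <= (1 + y) ^+ n.
Proof.
move=> y1; elim: n => [|n IHn]; first by rewrite mul0r addr0 expr0.
have y0 : 0 <= 1 + y by lra.
rewrite exprS; apply: le_trans (ler_wpM2l y0 IHn).
have := mulr_ge0 (ler0n R n) (sqr_ge0 y); rewrite -natr1; lra.
Qed.

Let M0 : 0 < M. Proof. exact: lt_le_trans M1. Qed.

Let mu_fin A : measurable A -> mu A \is a fin_num.
Proof. exact: fin_num_measure. Qed.

Let ip p : mu.-integrable setT (EFin \o (fun x => p.[x])).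
Proof. exact: (has_moments_poly p mus).1. Qed.

Let Ip p : \int[mu]_x p.[x] = mom s p.
Proof. exact: (has_moments_poly p mus).2. Qed.

Lemma markov_Rintegral D A (f : R -> R) (k : R) : measurable D -> measurable A ->
  mu.-integrable D (EFin \o f) -> (forall x, D x -> 0 <= f x) ->
  (forall x, D x -> A x -> k <= f x) -> k * fine (mu (A `&` D)) <= \int[mu]_(x in D) f x.
Proof.
move=> mD mA fi f0 kf.
have mi : measurable_fun D (\1_A : measurableTypeR R -> R) by exact: measurable_indic.
have Doo : (mu D < +oo)%E by rewrite (le_lt_trans (probability_le1 _ mD))// ltry.
have iA : mu.-integrable D (EFin \o (\1_A : measurableTypeR R -> R)).
  apply: (measurable_bounded_integrable mD Doo mi).
  - exists 1; split; first exact: num_real.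
    move=> y y1 x _ /=; apply: le_trans (ltW y1).
    by rewrite ger0_norm indicE// lern1 leq_b1.
have -> : fine (mu (A `&` D)) = \int[mu]_(x in D) (\1_A x : R).
  by rewrite /Rintegral integral_indic.
rewrite -RintegralZl//; apply: le_Rintegral => //; first exact: (integrableZl mD _ iA).
move=> x Dx; rewrite indicE; case: (boolP (x \in A)) => [|_].
  by rewrite inE mulr1 => /kf; exact.
by rewrite mulr0; exact: f0.
Qed.

(** Markov's inequality for x^(2n) compares (2 M)^(2n) with K M^(2n), so 4^n times the mass is at
    most K for every n. *)
Lemma tail_null : mu [set x | 2 * M < `|x|] = 0%E.
Proof.
set A := [set x | _].
have mA : measurable A.
  rewrite -[A]setCK; apply: measurableC; apply: is_interval_measurable => x y /=.
  move=> /negP; rewrite -leNgt ler_norml => /andP[x1 x2] /negP; rewrite -leNgt ler_norml.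
  move=> /andP[y1 y2] z /andP[xz zy]; apply/negP; rewrite -leNgt ler_norml.
  by rewrite (le_trans x1 xz) (le_trans zy y2).
have bound n : 4 ^+ n * fine (mu A) <= K.
  rewrite -(ler_pM2l (exprn_gt0 (2 * n) M0)) mulrA.
  have -> : M ^+ (2 * n) * 4 ^+ n = (2 * M) ^+ (2 * n).
    by rewrite exprMn mulrC [2 ^+ _]exprM; congr (_ ^+ _ * _); rewrite expr2 -natrM.
  rewrite -[A]setIT; apply: le_trans (_ : \int[mu]_x ('X^(2 * n)).[x] <= _).
    apply: markov_Rintegral => //; first by move=> x _; rewrite hornerXn exprM exprn_ge0// sqr_ge0.
    move=> x _ /ltW Ax; rewrite hornerXn exprM [leRHS]exprM.
    rewrite lerXn2r ?nnegrE ?sqr_ge0// -[x ^+ 2]real_normK ?num_real//.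
    by rewrite lerXn2r// nnegrE mulr_ge0// ltW.
  by rewrite Ip momXn mulrC (le_trans (ler_norm _)).
have m0 : 0 <= fine (mu A) by rewrite fine_ge0.
have K0 : 0 <= K by have := bound 0%N; rewrite expr0 mul1r; exact: le_trans.
have mE : fine (mu A) = 0.
  apply/eqP; rewrite eq_le m0 andbT; apply/ler_addgt0Pr => e e0; rewrite add0r.
  pose n := (Num.truncn (K / e)).+1.
  have Ke : K < n%:R * e by rewrite -ltr_pdivrMr// truncnS_gt.
  have n4 : n%:R <= 4 ^+ n :> R.
    have := @bernoulli_le 3 n; rewrite (_ : 1 + 3 = 4 :> R); last by ring.
    by move=> h; apply: le_trans (h _); have := ler0n R n; lra.
  rewrite -(ler_pM2l (_ : 0 < 4 ^+ n))//; apply: (le_trans (bound n)).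
  by apply: (le_trans (ltW Ke)); rewrite ler_wpM2r// ltW.
by rewrite -[mu A]fineK ?mu_fin// mE.
Qed.

Section Interval.
Variables (al be C : R).
Hypothesis C0 : 0 <= C.
Hypothesis kernel_bound : forall x0 p, al <= x0 <= be ->
  mom s p ^+ 2 <= C * mom s (p ^+ 2 * ('X - x0%:P) ^+ 2).

Let L := 2 * M + `|al| + `|be| + 1.
Let D : set (measurableTypeR R) := `[- L, L]%classic.

Let L0 : 0 < L.
Proof. by rewrite /L; have := normr_ge0 al; have := normr_ge0 be; have := M0; lra. Qed.

Let mD : measurable D. Proof. exact: measurable_itv. Qed.

Let DC0 : mu (~` D) = 0%E.
Proof.
apply: (subset_measure0 _ _ _ tail_null); [exact: measurableC| |].
  have -> : [set x | 2 * M < `|x|] = ~` `[- (2 * M), 2 * M]%classic.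
    by apply/seteqP; split => x /=; rewrite in_itv/= -ler_norml ltNge => /negP.
  by apply: measurableC; exact: measurable_itv.
move=> x; rewrite /D/= in_itv/= -ler_norml => /negP; rewrite -ltNge; apply: le_lt_trans.
by rewrite /L; have := normr_ge0 al; have := normr_ge0 be; lra.
Qed.

Let IpD p : \int[mu]_(x in D) p.[x] = mom s p.
Proof.
rewrite -Ip /Rintegral [in RHS](@negligible_integral _ _ _ _ _ (~` D))//.
- by rewrite setTD setCK.
- exact: measurableC.
- exact: ip.
Qed.

Let ipD p : mu.-integrable D (EFin \o (fun x => p.[x])).
Proof. exact: integrableS (ip p). Qed.

(* Testing the kernel bound against (1 - y)^n with y = ((x - x0) / 4L)^2. *)
Let small_interval x0 de : al <= x0 <= be -> 0 < de -> de <= be - al ->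
  `[x0 - de, x0 + de]%classic `<=` D ->
  fine (mu `[x0 - de, x0 + de]%classic) <= 8 * C * de ^+ 2.
Proof.
move=> x0ab de0 deab ID.
have x0L : `|x0| <= L.
  case/andP : x0ab => h1 h2; rewrite ler_norml /L.
  have := ler_norm al; have := ler_norm be; have := ler_norm (- al); have := ler_norm (- be).
  by rewrite !normrN; have := M0; lra.
pose Y : {poly R} := (4 * L)^-2 *: ('X - x0%:P) ^+ 2.
have YE x : Y.[x] = ((x - x0) / (4 * L)) ^+ 2.
  by rewrite /Y hornerZ horner_exp hornerXsubC expr_div_n mulrC.
have YD x : D x -> 0 <= Y.[x] <= 1.
  rewrite /D/= in_itv/= -ler_norml => xL; rewrite YE sqr_ge0/=.
  rewrite -real_normK ?num_real// expr_le1// normrM normfV [`|4 * L|]gtr0_norm ?mulr_gt0//.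
  rewrite ler_pdivrMr ?mulr_gt0// mul1r (le_trans (ler_normB _ _))//.
  by have := L0; lra.
have de4 : de <= 2 * L.
  apply: (le_trans deab); rewrite /L.
  have := ler_norm (- al); have := ler_norm be; rewrite normrN.
  by have := normr_ge0 al; have := normr_ge0 be; have := M0; lra.
(* n is of order (L / de)^2: [n1] makes (1 - Y)^n at least 1/2 on the interval, and [n2] turns phi
   <= 16 C L^2 / n into a bound of order de^2. *)
pose n := Num.truncn (8 * L ^+ 2 / de ^+ 2).
have de2 : 0 < de ^+ 2 by exact: exprn_gt0.
have q0 : 0 <= 8 * L ^+ 2 / de ^+ 2 by rewrite divr_ge0 ?sqr_ge0// mulr_ge0// sqr_ge0.
have n1 : n%:R * de ^+ 2 <= 8 * L ^+ 2.
  by rewrite -ler_pdivlMr//; have /andP[] := truncn_itv q0.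
have LL : de ^+ 2 <= 4 * L ^+ 2.
  have -> : 4 * L ^+ 2 = (2 * L) ^+ 2 by ring.
  by rewrite lerXn2r// nnegrE ltW// mulr_gt0.
have n2 : 4 * L ^+ 2 <= n%:R * de ^+ 2.
  have /andP[_] := truncn_itv q0; rewrite -/n ltr_pdivrMr// -natr1 mulrDl mul1r.
  by lra.
have n0 : 0 < n%:R :> R.
  rewrite -(pmulr_lgt0 _ de2); apply: lt_le_trans n2.
  by rewrite mulr_gt0// exprn_gt0.
pose phi := mom s ((1 - Y) ^+ n).
(* On D, n y (1 - y)^n <= (1 + y)^n (1 - y)^n <= 1; this absorbs the factor Y on the right of the
   kernel bound. *)
have phi_n : n%:R * phi ^+ 2 <= C * (16 * L ^+ 2) * phi.
  have := kernel_bound ((1 - Y) ^+ n) x0ab; rewrite -/phi.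
  have -> : ('X - x0%:P) ^+ 2 = (16 * L ^+ 2) *: Y.
    rewrite /Y scalerA [X in X *: _](_ : _ = 1) ?scale1r//.
    by field; exact: lt0r_neq0.
  rewrite -scalerAr linearZ/= => h.
  have {h} := ler_wpM2l (ltW n0) h; move=> /le_trans; apply.
  set m2 := mom s _.
  have -> : n%:R * (C * (16 * L ^+ 2 * m2)) = C * (16 * L ^+ 2) * (n%:R * m2) by ring.
  rewrite {}/m2; apply: ler_wpM2l; first by rewrite mulr_ge0// mulr_ge0// sqr_ge0.
  have momZ k p : k * mom s p = mom s (k *: p) by rewrite linearZ.
  rewrite momZ /phi -!IpD; apply: le_Rintegral => //.
  move=> x Dx; have /andP[y0 y1] := YD x Dx.
  rewrite hornerZ hornerM expr2 hornerM horner_exp hornerD hornerN hornerC.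
  set y := Y.[x] in y0 y1 *; set z := (1 - y) ^+ n.
  have z0 : 0 <= z by rewrite exprn_ge0// subr_ge0.
  have -> : n%:R * (z * z * y) = z * (z * (n%:R * y)) by ring.
  rewrite -[leRHS]mulr1; apply: ler_wpM2l => //.
  have h1 : n%:R * y <= (1 + y) ^+ n.
    apply: le_trans (bernoulli_le n _); last by lra.
    by rewrite lerDr.
  apply: (@le_trans _ _ (z * (1 + y) ^+ n)); first exact: ler_wpM2l.
  by rewrite /z -exprMn; apply: exprn_ile1; nra.
have mI : measurable (`[x0 - de, x0 + de]%classic : set (measurableTypeR R)).
  exact: measurable_itv.
set I := `[x0 - de, x0 + de]%classic in ID mI *.
have half : 2^-1 * fine (mu I) <= phi.
  rewrite -(setIidl ID) /phi -IpD; apply: markov_Rintegral => //.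
    move=> x Dx; have /andP[y0 y1] := YD x Dx.
    by rewrite horner_exp hornerD hornerN hornerC exprn_ge0// subr_ge0.
  move=> x Dx; rewrite /I/= in_itv/= => /andP[x1 x2]; have /andP[y0 y1] := YD x Dx.
  rewrite horner_exp hornerD hornerN hornerC.
  apply: le_trans (bernoulli_le n _); last by rewrite lerN2.
  have : n%:R * Y.[x] <= 2^-1.
    rewrite YE expr_div_n.
    have xd : (x - x0) ^+ 2 <= de ^+ 2.
      by rewrite -[(x - x0) ^+ 2]real_normK ?num_real// lerXn2r ?nnegrE ?(ltW de0)// ler_norml; lra.
    rewrite mulrA ler_pdivrMr ?exprn_gt0 ?mulr_gt0//.
    apply: le_trans (ler_wpM2l (ltW n0) xd) _; apply: (le_trans n1).
    by rewrite exprMn; lra.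
  by lra.
have m0 : 0 <= fine (mu I) by rewrite fine_ge0.
have [ph0|ph0] := leP phi 0.
  apply: (@le_trans _ _ 0); first by lra.
  by rewrite mulr_ge0 ?mulr_ge0// ltW.
have phin : n%:R * phi <= C * (16 * L ^+ 2).
  by rewrite -(ler_pM2r ph0) -mulrA -expr2.
have LL0 : 0 < 4 * L ^+ 2 by rewrite mulr_gt0// exprn_gt0.
rewrite -(ler_pM2l LL0); apply: (@le_trans _ _ (n%:R * de ^+ 2 * (2 * phi))).
  by apply: ler_pM => //; [exact: ltW|lra].
have := ler_wpM2r (ltW de2) phin; lra.
Qed.

(** The mass is bounded by the square of the length. Cutting into 2^k equal pieces divides each
    bound by 4^k, so the total is of order 2^-k. *)
Lemma interval_null : al < be -> mu `[al, be]%classic = 0%E.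
Proof.
move=> ab.
have mI x y : measurable (`[x, y]%classic : set (measurableTypeR R)) by exact: measurable_itv.
have halving k : forall x y, al <= x -> x < y -> y <= be ->
    fine (mu `[x, y]%classic) <= 2 * C * (y - x) ^+ 2 / 2 ^+ k.
  elim: k => [|k IHk] x y ax xy yb.
    rewrite expr0 divr1; pose x0 := (x + y) / 2; pose de := (y - x) / 2.
    have -> : x = x0 - de by rewrite /x0 /de; field.
    have -> : y = x0 + de by rewrite /x0 /de; field.
    have -> : 2 * C * (x0 + de - (x0 - de)) ^+ 2 = 8 * C * de ^+ 2 by ring.
    apply: small_interval; rewrite /x0 /de; [lra|lra|lra|].
    have -> : (x + y) / 2 - (y - x) / 2 = x by field.
    have -> : (x + y) / 2 + (y - x) / 2 = y by field.
    move=> t; rewrite /D/= !in_itv/= => /andP[xt ty].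
    have := ler_norm be; have := ler_norm (- al); rewrite normrN /L.
    by have := normr_ge0 al; have := normr_ge0 be; have := M0; lra.
  pose z := (x + y) / 2.
  have xz : x < z by rewrite /z; lra.
  have zy : z < y by rewrite /z; lra.
  have h1 := IHk x z ax xz (ltW (lt_le_trans zy yb)).
  have h2 := IHk z y (ltW (le_lt_trans ax xz)) zy yb.
  have -> : 2 * C * (y - x) ^+ 2 / 2 ^+ k.+1 =
      2 * C * (z - x) ^+ 2 / 2 ^+ k + 2 * C * (y - z) ^+ 2 / 2 ^+ k.
    have q0 : 2 ^+ k != 0 :> R by rewrite expf_neq0.
    by move: q0; rewrite [2 ^+ k.+1]exprS /z; move: (2 ^+ k) => q q0; field.
  apply: le_trans (lerD h1 h2); rewrite -fineD ?mu_fin// fine_le ?mu_fin//.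
    by rewrite fin_numD !mu_fin.
  apply: le_trans (measureU2 mu (mI _ _) (mI _ _)); apply: le_measure; rewrite ?inE//.
    exact: measurableU.
  move=> t /=; rewrite !in_itv/= => /andP[xt ty].
  by have [tz|/ltW tz] := leP t z; [left; rewrite xt|right; rewrite tz].
have m0 : 0 <= fine (mu `[al, be]%classic) by rewrite fine_ge0.
suff mE : fine (mu `[al, be]%classic) = 0 by rewrite -[mu _]fineK ?mu_fin// mE.
apply/eqP; rewrite eq_le m0 andbT; apply/ler_addgt0Pr => e e0; rewrite add0r.
set A := 2 * C * (be - al) ^+ 2.
pose n := (Num.truncn (A / e)).+1.
have An : A < n%:R * e by rewrite -ltr_pdivrMr// truncnS_gt.
have n2 : n%:R <= 2 ^+ n :> R.
  have := @bernoulli_le 1 n; rewrite mulr1 (_ : 1 + 1 = 2 :> R); last by ring.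
  by move=> h; apply: le_trans (h _); lra.
apply: (le_trans (halving n _ _ (lexx _) ab (lexx _))); rewrite -/A.
rewrite ler_pdivrMr ?exprn_gt0// mulrC; apply: (le_trans (ltW An)).
by rewrite ler_wpM2r// ltW.
Qed.

End Interval.
End Localization.

(** * Critical values of the cubic and endpoints of the support *)

Section Support.
Variables (R : realType) (a b : R).
Local Notation c := (c a b).

Definition cubic (w : R) := w - a * w ^+ 2 - b * w ^+ 3.
Definition cubic' (w : R) := 1 - 2 * a * w - 3 * b * w ^+ 2.
(** For b < 0 the set P' > 0 may have two components, separated by the vertex -a/(3b); the sign
    condition keeps the side of 0. *)
Definition admissible (w : R) := 0 < cubic' w /\
  (0 < b \/ [/\ b < 0, 0 <= a ^+ 2 + 3 * b & 0 < a * (a + 3 * b * w)]).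

Lemma cubic_continuous : continuous cubic.
Proof.
have -> : cubic = horner ('X - a *: 'X^2 - b *: 'X^3).
  by apply/funext => w; rewrite /cubic !(hornerD, hornerN, hornerZ, hornerX, hornerXn).
exact: continuous_horner.
Qed.

(* Simpson's rule is exact for the quadratic polynomial cubic'. *)
Lemma cubic_lt u v : u < v -> (forall w, u <= w <= v -> 0 < cubic' w) -> cubic u < cubic v.
Proof.
move=> uv h; have vu0 : 0 < v - u by rewrite subr_gt0.
rewrite -subr_gt0.
have -> : cubic v - cubic u = (v - u) * ((cubic' u + cubic' v + 4 * cubic' ((u + v) / 2)) / 6).
  by rewrite /cubic /cubic'; field.
rewrite mulr_gt0// divr_gt0//.
have h1 : 0 < cubic' u by apply: h; rewrite lexx ltW.
have h2 : 0 < cubic' v by apply: h; rewrite lexx ltW.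
have h3 : 0 < cubic' ((u + v) / 2) by apply: h; lra.
by lra.
Qed.

Lemma admissible_near w (x : R) : admissible w -> x * cubic w = 1 -> exists2 e, 0 < e &
  forall v, `|v - w| <= e -> [/\ admissible v, cubic' w / 2 < cubic' v & 0 < x * cubic v].
Proof.
move=> [k0 wP] xw.
pose q1 : {poly R} := (1 - cubic' w / 2)%:P - (2 * a) *: 'X - (3 * b) *: 'X^2.
pose q2 : {poly R} := x *: ('X - a *: 'X^2 - b *: 'X^3).
pose q3 : {poly R} := if 0 < b then 1 else a *: (a%:P + (3 * b) *: 'X).
have q1E v : q1.[v] = cubic' v - cubic' w / 2.
  by rewrite /q1 !(hornerD, hornerN, hornerZ, hornerX, hornerXn, hornerC) /cubic'; ring.
have q2E v : q2.[v] = x * cubic v.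
  by rewrite /q2 hornerZ !(hornerD, hornerN, hornerZ, hornerX, hornerXn).
have n1 : \forall v \near w, 0 < q1.[v].
  by apply: (cvgr_gt _ (@continuous_horner _ q1 w)); rewrite q1E; lra.
have n2 : \forall v \near w, 0 < q2.[v].
  by apply: (cvgr_gt _ (@continuous_horner _ q2 w)); rewrite q2E xw.
have n3 : \forall v \near w, 0 < q3.[v].
  apply: (cvgr_gt _ (@continuous_horner _ q3 w)); rewrite /q3.
  case: wP => [->|[bn _ h]]; first by rewrite hornerC.
  by rewrite (lt_gtF bn) !(hornerD, hornerZ, hornerX, hornerC).
have /nbhs_ballP[e /= e0 he] : \forall v \near w, [/\ 0 < q1.[v], 0 < q2.[v] & 0 < q3.[v]].
  by near=> v; split; near: v.
exists (e / 2); first by rewrite divr_gt0.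
move=> v vw; have [] := he v.
  by rewrite /ball/= distrC (le_lt_trans vw)//; lra.
rewrite q1E q2E subr_gt0 => h1 h2 h3; split => //; split; first by lra.
case: wP => [b0|[bn ab _]]; [by left|right; split => //].
by move: h3; rewrite /q3 (lt_gtF bn) !(hornerD, hornerZ, hornerX, hornerC).
Unshelve. all: by end_near. Qed.

(** By monotonicity and the intermediate value theorem, a neighbourhood of x consists of points
    1/P(v) with v admissible. There (1 - z X)^2 = z^2 (X - 1/z)^2 turns the resolvent inequality
    into a kernel bound with a uniform constant. *)
Lemma notin_support (mu : probability (measurableTypeR R) R) w x :
  has_moments mu c -> admissible w -> x * cubic w = 1 -> ~ measure_support mu x.
Proof.
move=> muc adm xw supp.
have [e e0 he] := admissible_near adm xw.
pose w1 := w - e; pose w2 := w + e.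
have near v : w1 <= v <= w2 -> `|v - w| <= e by rewrite ler_norml /w1 /w2; lra.
have k0 : 0 < cubic' w := adm.1.
have lt_w u v : w1 <= u -> u < v -> v <= w2 -> cubic u < cubic v.
  move=> h1 h2 h3; apply: cubic_lt => // t /andP[ut tv].
  have tb : w1 <= t <= w2 by rewrite (le_trans h1 ut) (le_trans tv h3).
  by have [_ h _] := he t (near t tb); lra.
have c1 : cubic w1 < cubic w by apply: lt_w; rewrite /w1 /w2; lra.
have c2 : cubic w < cubic w2 by apply: lt_w; rewrite /w1 /w2; lra.
have x1 : 0 < x * cubic w1.
  have [|//] := he w1; apply: near; rewrite /w1 /w2; lra.
have x2 : 0 < x * cubic w2.
  have [|//] := he w2; apply: near; rewrite /w1 /w2; lra.
have x0 : x != 0 by apply: contraTneq x1 => ->; rewrite mul0r ltxx.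
have cw0 : cubic w != 0.
  by apply/eqP => h; move: xw; rewrite h mulr0 => /eqP; rewrite eq_sym oner_eq0.
have xE : x = (cubic w)^-1 by rewrite -[x](mulfK cw0) xw mul1r.
have same u v : 0 < x * u -> 0 < x * v -> u < v -> v^-1 < u^-1.
  move=> xu xv uv; have uv0 : 0 < u * v.
    have := mulr_gt0 xu xv; rewrite mulrACA -expr2 pmulr_rgt0// exprn_even_gt0//.
  have u0 : u != 0 by apply: contraTneq uv0 => ->; rewrite mul0r ltxx.
  have v0 : v != 0 by apply: contraTneq uv0 => ->; rewrite mulr0 ltxx.
  by rewrite -(ltr_pM2l uv0) mulfK// mulrAC divff// mul1r.
have xw0 : 0 < x * cubic w by rewrite xw.
pose al := (cubic w2)^-1; pose be := (cubic w1)^-1.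
have alx : al < x by rewrite /al xE; exact: same.
have xbe : x < be by rewrite /be xE; exact: same.
have albe : al < be := lt_trans alx xbe.
(* The numerator bounds P(v)^2, since P(v) lies between P(w1) and P(w2); the denominator bounds
   P'(v) from below. *)
pose C := (cubic w1 ^+ 2 + cubic w2 ^+ 2) / (cubic' w / 2).
have kw : 0 < cubic' w / 2 by rewrite divr_gt0.
have C0 : 0 <= C by rewrite divr_ge0 ?(ltW kw)// addr_ge0// sqr_ge0.
have [K [M [_ M1 cM]]] := c_geometric a b.
have inv_between x0' : al <= x0' <= be -> x0' != 0 /\ cubic w1 <= x0'^-1 <= cubic w2.
  move=> /andP[ax xb]; have [xn|xp|x0E] := ltgtP x 0; last by rewrite x0E eqxx in x0.
    rewrite nmulr_rgt0// in x1; rewrite nmulr_rgt0// in x2.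
    have be0 : be < 0 by rewrite /be invr_lt0.
    have x0'n : x0' < 0 by exact: le_lt_trans be0.
    have al0 : al < 0 by rewrite /al invr_lt0.
    split; first by rewrite lt_eqF.
    rewrite -[cubic w1]invrK -[cubic w2]invrK -/al -/be.
    by rewrite !lef_nV2 ?negrE// ax xb.
  rewrite pmulr_rgt0// in x1; rewrite pmulr_rgt0// in x2.
  have al0 : 0 < al by rewrite /al invr_gt0.
  have be0 : 0 < be by rewrite /be invr_gt0.
  have x0'p : 0 < x0' by exact: lt_le_trans ax.
  split; first by rewrite gt_eqF.
  rewrite -[cubic w1]invrK -[cubic w2]invrK -/al -/be.
  by rewrite !lef_pV2 ?posrE// ax xb.
have kb x0' p : al <= x0' <= be ->
    mom c p ^+ 2 <= C * mom c (p ^+ 2 * ('X - x0'%:P) ^+ 2).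
  move=> /inv_between[x0'0 x0'b].
  have [v v12 vx] : exists2 v, v \in `[w1, w2] & cubic v = x0'^-1.
    apply: IVT; first by rewrite /w1 /w2; lra.
      exact/continuous_subspaceT/cubic_continuous.
    have c12 := ltW (lt_trans c1 c2).
    by rewrite (min_idPl c12) (max_idPr c12).
  rewrite in_itv/= in v12.
  have [[kv vP] kv2 _] := he v (near v v12).
  have h : mom c p ^+ 2 * cubic' v <= mom c ((p * (1 - cubic v *: 'X)) ^+ 2).
    exact: mom_resolvent_le.
  have e3 : (p * (1 - cubic v *: 'X)) ^+ 2 = (cubic v ^+ 2) *: (p ^+ 2 * ('X - x0'%:P) ^+ 2).
    have e2 : 1 - cubic v *: 'X = (- cubic v) *: ('X - x0'%:P).
      have e1 : (cubic v)%:P * x0'%:P = 1 by rewrite -polyCM vx mulVf.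
      by rewrite -!mul_polyC polyCN -{1}e1; ring.
    by rewrite e2 -!mul_polyC polyCN rmorphXn/=; ring.
  have momZ k q : mom c (k *: q) = k * mom c q by rewrite linearZ.
  rewrite e3 momZ in h.
  have m0 : 0 <= mom c (p ^+ 2 * ('X - x0'%:P) ^+ 2).
    rewrite -exprMn -(has_moments_poly _ muc).2; apply: Rintegral_ge0 => t _.
    by rewrite horner_exp sqr_ge0.
  have cv2 : cubic v ^+ 2 <= cubic w1 ^+ 2 + cubic w2 ^+ 2.
    move: x0'b; rewrite -vx => /andP[h1 h2].
    have [v0|v0] := leP 0 (cubic v).
      have : cubic v ^+ 2 <= cubic w2 ^+ 2 by rewrite lerXn2r// nnegrE// (le_trans v0).
      by have := sqr_ge0 (cubic w1); lra.
    have : (- cubic v) ^+ 2 <= (- cubic w1) ^+ 2.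
      by rewrite lerXn2r// ?nnegrE ?oppr_ge0 ?lerN2// ?(ltW v0)// (le_trans h1)// ltW.
    by rewrite !sqrrN; have := sqr_ge0 (cubic w2); lra.
  rewrite /C mulrAC ler_pdivlMr//.
  apply: le_trans (_ : mom c p ^+ 2 * cubic' v <= _).
    by rewrite ler_wpM2l ?sqr_ge0// ltW.
  by apply: (le_trans h); rewrite ler_wpM2r.
have null := interval_null muc M1 cM C0 kb albe.
have := supp `]al, be[%classic (@interval_open R (BRight al) (BLeft be) isT isT).
rewrite /= in_itv/= alx xbe => /(_ isT); apply/negP; rewrite -leNgt -null.
apply: le_measure; rewrite ?inE; [exact: measurable_itv|exact: measurable_itv|].
by apply: subset_itv_oo_cc.
Qed.

Lemma powR32 (y : R) : 0 <= y -> y `^ (3 / 2) = Num.sqrt y ^+ 3.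
Proof.
by move=> y0; rewrite mulrC powRrM powR12_sqrt// powR_mulrn// sqrtr_ge0.
Qed.

Section Roots.
Hypothesis b0 : b != 0.
Hypothesis disc : 0 <= a ^+ 2 + 3 * b.
Let r := Num.sqrt (a ^+ 2 + 3 * b).
Let wp := (- a + r) / (3 * b).
Let wm := (- a - r) / (3 * b).

Let r2 : r ^+ 2 = a ^+ 2 + 3 * b. Proof. exact: sqr_sqrtr. Qed.

Lemma cubic'_roots w : cubic' w = - (3 * b) * ((w - wp) * (w - wm)).
Proof.
have -> : (w - wp) * (w - wm) = w ^+ 2 + 2 * a / (3 * b) * w + (a ^+ 2 - r ^+ 2) / (3 * b) ^+ 2.
  by rewrite /wp /wm; field.
by rewrite r2 /cubic'; field.
Qed.

Lemma z_plusE : z_plus a b = cubic wp.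
Proof.
rewrite /z_plus powR32// -/r /cubic.
have -> : wp - a * wp ^+ 2 - b * wp ^+ 3 =
    (- a + r) / (27 * b ^+ 2) * (9 * b - 3 * a * (- a + r) - (- a + r) ^+ 2).
  by rewrite /wp; field.
(* Once b is eliminated from the numerators, both sides agree as polynomials in a and r. *)
have -> : 9 * b = 3 * r ^+ 2 - 3 * a ^+ 2 by rewrite r2; ring.
have -> : - 2 * a ^+ 3 - 9 * a * b = - 2 * a ^+ 3 - a * (3 * r ^+ 2 - 3 * a ^+ 2).
  by rewrite r2; ring.
by field.
Qed.

Lemma z_minusE : z_minus a b = cubic wm.
Proof.
rewrite /z_minus powR32// -/r /cubic.
have -> : wm - a * wm ^+ 2 - b * wm ^+ 3 =
    (- a - r) / (27 * b ^+ 2) * (9 * b - 3 * a * (- a - r) - (- a - r) ^+ 2).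
  by rewrite /wm; field.
have -> : 9 * b = 3 * r ^+ 2 - 3 * a ^+ 2 by rewrite r2; ring.
have -> : - 2 * a ^+ 3 - 9 * a * b = - 2 * a ^+ 3 - a * (3 * r ^+ 2 - 3 * a ^+ 2).
  by rewrite r2; ring.
by field.
Qed.

(** Makes the signs of the critical values visible. *)
Lemma cubic_critical w : cubic' w = 0 -> cubic w = w ^+ 2 * (a + 2 * b * w).
Proof.
move=> h; have -> : cubic w = w * cubic' w + w ^+ 2 * (a + 2 * b * w).
  by rewrite /cubic /cubic'; ring.
by rewrite h mulr0 add0r.
Qed.

Let cubic_wp : cubic wp = wp ^+ 2 * ((a + 2 * r) / 3).
Proof.
rewrite cubic_critical; last by rewrite cubic'_roots subrr mul0r mulr0.
by congr (_ * _); rewrite /wp; field.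
Qed.

Let cubic_wm : cubic wm = wm ^+ 2 * ((a - 2 * r) / 3).
Proof.
rewrite cubic_critical; last by rewrite cubic'_roots subrr !mulr0.
by congr (_ * _); rewrite /wm; field.
Qed.

Lemma cubic_IVT u v y : u <= v -> cubic u < y -> y < cubic v ->
  exists2 w, u < w < v & cubic w = y.
Proof.
move=> uv uy yv; have [||w] := @IVT R cubic u v y uv.
- exact/continuous_subspaceT/cubic_continuous.
- by have h := ltW (lt_trans uy yv); rewrite (min_idPl h) (max_idPr h) (ltW uy) (ltW yv).
move=> + wy; rewrite in_itv/= => /andP[uw wv]; exists w => //.
rewrite !lt_neqAle uw wv !andbT; apply/andP; split.
  by apply: contraTneq uy => ->; rewrite wy ltxx.
by apply: contraTneq yv => <-; rewrite wy ltxx.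
Qed.

Let cubic0 : cubic 0 = 0. Proof. by rewrite /cubic; ring. Qed.

Hypothesis a0 : 0 < a.

(** Here 0 < wp <= wm, and P maps the admissible ray below wp onto the ray below z_+; reciprocals of
    its nonzero values fill the complement of [0, tau_+]. *)
Lemma support_neg (mu : probability (measurableTypeR R) R) : b < 0 ->
  has_moments mu c -> measure_support mu `<=` `[0, tau_plus a b].
Proof.
move=> bn muc x supp; rewrite /= in_itv/= /tau_plus div1r z_plusE.
have r0 : 0 <= r by exact: sqrtr_ge0.
have ra : r < a by rewrite -(@ltr_pXn2r _ 2)// ?nnegrE ?(ltW a0)// r2; lra.
have wp0 : 0 < wp by rewrite /wp nmulr_lgt0 ?invr_lt0; lra.
have wpm : wp <= wm.
  by rewrite /wp /wm ler_nM2r ?invr_lt0; lra.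
have adm w : w < wp -> admissible w.
  move=> wwp; split; [|right; split => //].
    rewrite cubic'_roots pmulr_rgt0 ?nmulr_rgt0; lra.
  rewrite pmulr_rgt0//.
  have : 3 * b * wp < 3 * b * w by rewrite ltr_nM2l//; lra.
  have -> : 3 * b * wp = - a + r by rewrite /wp; field.
  by lra.
have zp0 : 0 < cubic wp by rewrite cubic_wp mulr_gt0 ?exprn_gt0//; lra.
have no w : w < wp -> x * cubic w = 1 -> False.
  by move=> /adm h xw; exact: (notin_support muc h xw supp).
apply/andP; split; rewrite leNgt; apply/negP => h.
  have xi : x^-1 < 0 by rewrite invr_lt0.
  (* At 2/x < 0 the terms -a w^2 and -b w^3 are nonpositive, so P(2/x) <= 2/x < 1/x. *)
  have [|||w /andP[_ w0] wx] := @cubic_IVT (2 * x^-1) 0 x^-1; first by lra.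
  - rewrite /cubic; have := mulr_ge0 (ltW a0) (sqr_ge0 (2 * x^-1)).
    have : 0 <= b * (2 * x^-1) ^+ 3.
      rewrite nmulr_rge0// exprS nmulr_rle0 ?sqr_ge0//; lra.
    by lra.
  - by rewrite cubic0.
  by apply: (no w); [exact: lt_trans wp0|rewrite wx divff// lt_eqF].
have xp : 0 < x by apply: lt_trans h; rewrite invr_gt0.
have [||w /andP[_ w0] wx] := @cubic_IVT 0 wp x^-1 (ltW wp0).
- by rewrite cubic0 invr_gt0.
- by rewrite -[cubic wp]invrK ltf_pV2 ?posrE// invr_gt0.
by apply: (no w) => //; rewrite wx divff// gt_eqF.
Qed.

(** Here wm < 0 < wp, and P maps ]wm, wp[ onto ]z_-, z_+[ with z_- < 0 < z_+; reciprocals of its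
    nonzero values fill the complement of [tau_-, tau_+]. *)
Lemma support_pos (mu : probability (measurableTypeR R) R) : 0 < b ->
  has_moments mu c -> measure_support mu `<=` `[tau_minus a b, tau_plus a b].
Proof.
move=> bp muc x supp; rewrite /= in_itv/= /tau_plus /tau_minus !div1r z_plusE z_minusE.
have r0 : 0 <= r by exact: sqrtr_ge0.
have ra : a < r by rewrite -(@ltr_pXn2r _ 2)// ?nnegrE ?(ltW a0)// r2 ltrDl mulr_gt0.
have b3 : 0 < 3 * b by rewrite mulr_gt0.
have wp0 : 0 < wp by rewrite /wp divr_gt0//; lra.
have wm0 : wm < 0.
  by rewrite /wm -opprD mulNr oppr_lt0 divr_gt0// addr_gt0// (lt_trans a0 ra).
have adm w : wm < w < wp -> admissible w.
  move=> /andP[h1 h2]; split; [|by left].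
  rewrite cubic'_roots mulNr -mulrN -mulNr opprB.
  by rewrite !mulr_gt0// subr_gt0.
have rp : 0 < r := lt_trans a0 ra.
have zp0 : 0 < cubic wp.
  by rewrite cubic_wp mulr_gt0 ?exprn_gt0// divr_gt0// addr_gt0// mulr_gt0.
have zm0 : cubic wm < 0.
  have wm2 : 0 < wm ^+ 2 by rewrite exprn_even_gt0//= lt_eqF.
  by rewrite cubic_wm pmulr_rlt0// pmulr_llt0 ?invr_gt0// subr_lt0 (lt_trans ra)// ltr_pMl// ltr1n.
have no w : wm < w < wp -> x * cubic w = 1 -> False.
  by move=> /adm h xw; exact: (notin_support muc h xw supp).
apply/andP; split; rewrite leNgt; apply/negP => h.
  have xn : x < 0 by apply: lt_trans h _; rewrite invr_lt0.
  have [||w /andP[w1 w2] wx] := @cubic_IVT wm 0 x^-1 (ltW wm0).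
  - by rewrite -[cubic wm]invrK ltf_nV2 ?negrE// invr_lt0.
  - by rewrite cubic0 invr_lt0.
  by apply: (no w); [rewrite w1 (lt_trans w2)|rewrite wx divff// lt_eqF].
have xp : 0 < x by apply: lt_trans h; rewrite invr_gt0.
have [||w /andP[w1 w2] wx] := @cubic_IVT 0 wp x^-1 (ltW wp0).
- by rewrite cubic0 invr_gt0.
- by rewrite -[cubic wp]invrK ltf_pV2 ?posrE// invr_gt0.
by apply: (no w); [rewrite w2 (lt_trans wm0)|rewrite wx divff// gt_eqF].
Qed.

End Roots.

End Support.

Theorem theorem6p5 (R : realType) (a b : R) (hb : b != 0) :
  (positive_definite (c a b) <-> 0 <= a ^+ 2 + 3 * b) /\
  (0 < a ->
   forall mu : probability (measurableTypeR R) R, has_moments mu (c a b) ->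
     (b < 0 -> 0 <= a ^+ 2 + 3 * b ->
        measure_support mu `<=` `[0, tau_plus a b]) /\
     (0 < b ->
        measure_support mu `<=` `[tau_minus a b, tau_plus a b])).
Proof.
split.
  split=> [[mu muc]|ab].
    apply: discriminant_ge0 => // p; rewrite -(has_moments_poly _ muc).2.
    by apply: Rintegral_ge0 => x _; rewrite horner_exp sqr_ge0.
  have [K [M [_ M1 cM]]] := c_geometric a b.
  apply: (hamburger_bounded (c0 a b) (lt_le_trans ltr01 M1) cM) => p.
  exact: mom_sqr_ge0.
move=> a0 mu muc; split=> [bn ab|bp]; first exact: support_neg.
by apply: support_pos => //; rewrite addr_ge0 ?sqr_ge0// mulr_ge0// ltW.
Qed.
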